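(* A continuum $K\subset\mathbb{C}$ is locally connected if and only if it satisfies the Schönflies condition.
   Context: A compactum is a compact metric space; a continuum is a connected compactum. For two parallel lines $L_1,L_2$ in the plane, $U(L_1,L_2)$ denotes the unbounded open strip bounded by them, i.e. the component of $\mathbb{C}\setminus(L_1\cup L_2)$ with boundary $L_1\cup L_2$. A compactum $K\subset\mathbb{C}$ satisfies the Schönflies condition if for any two (distinct) parallel lines $L_1,L_2$, with $U=U(L_1,L_2)$, the difference $\overline{U}\setminus K$ has at most finitely many components intersecting both $L_1$ and $L_2$. *)

(* Defs.v *)
From mathcomp Require Import all_boot all_order all_algebra.
From mathcomp Require Import all_classical all_reals topology normedtype.

Set Implicit Arguments.
Unset Strict Implicit.
Unset Printing Implicit Defensive.

Import Order.TTheory GRing.Theory Num.Theory.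
Import numFieldNormedType.Exports.

Local Open Scope ring_scope.
Local Open Scope classical_set_scope.

(* The complex plane is rendered as R * R with its product topology. *)

Section Topology.
Context {T : topologicalType}.

Definition components (A : set T) : set (set T) :=
  [set connected_component A x | x in A].

Definition frontier (A : set T) : set T := closure A `&` closure (~` A).

(* The subspace A has a base of connected open sets.  Its open sets are the
   traces A `&` O, and [connected (A `&` O)] does not depend on whether
   connectedness is tested in A or in T. *)
Definition locally_connected (A : set T) : Prop :=
  forall (x : T) (V : set T), A x -> nbhs x V ->
    exists O : set T, [/\ open O, O x, A `&` O `<=` V & connected (A `&` O)].

Definition continuum (A : set T) : Prop := compact A /\ connected A.

End Topology.

Section Plane.
Context {R : realType}.

Definition line (a v : R * R) : set (R * R) :=
  [set a + t *: v | t in [set: R]].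

Definition parallel_lines (L1 L2 : set (R * R)) : Prop :=
  exists v a b : R * R, [/\ v != 0, L1 = line a v & L2 = line b v].

(* For distinct parallel lines exactly one component of the complement has the
   whole of [L1 `|` L2] as its frontier: the open strip between them; the other
   two are half-planes. *)
Definition strip (L1 L2 U : set (R * R)) : Prop :=
  components (~` (L1 `|` L2)) U /\ frontier U = L1 `|` L2.

Definition schoenflies (K : set (R * R)) : Prop :=
  forall L1 L2 U : set (R * R),
    parallel_lines L1 L2 -> L1 <> L2 -> strip L1 L2 U ->
    finite_set [set C | [/\ components (closure U `\` K) C,
                            C `&` L1 !=set0 & C `&` L2 !=set0]].

End Plane.

(* Main.v *)
Require Import Defs.
From mathcomp Require Import all_boot all_order all_algebra.
From mathcomp Require Import all_classical all_reals topology normedtype.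
From mathcomp Require Import derive finmap ring lra.

(** Call a continuum that joins both edges of a closed vertical strip, inside the
    strip, a wall of the strip. Two planar facts relate the walls contained in [K]
    to the components of the complement of [K] that cross the strip.

    - A connected set in the strip that avoids a wall stays on one side of it
      ([same_side]). The proof approximates the connected set by a chain of
      points with short steps and counts modulo 2 how often the chain crosses
      a horizontal ray issued from a point of the wall.

    - If [A] and [B] are disjoint closed sets, each containing a point of the
      left edge of a box, and [A] avoids the top and the bottom, then a continuum
      in the complement of both starts on the left edge between these points and
      ends on the right edge, or on the left edge beyond one of them
      ([crossing_between]). This is a parity argument on a fine grid.

    Suppose that [K] is locally connected and that infinitely many components of
    the complement cross a strip. They accumulate at a point [z] of the middle
    line. A small connected neighbourhood of [z] in [K] joins the part of [K]
    just above the lowest of three crossing components that come close to [z]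
    to the part just below the highest one, and so bypasses the middle one. This
    contradicts the first fact ([three_crossings],
    [locally_connected_finite_crossings]).

    Conversely, suppose that every strip has finitely many crossing components.
    For a square centred at a point of [K], consider the components of the trace
    of [K] on the square that come close to the centre. By boundary bumping they
    reach a side of the square, hence contain walls of the strip of half the
    radius along that side. Out of three such walls, the middle one belongs to
    a component that the others confine, so that the second fact puts a crossing
    component of the complement between two of them. Finitely many crossing
    components thus bound the number of walls ([finite_box_components]). Hence the component of the
    trace at the centre is a neighbourhood of the centre in [K], which gives
    local connectedness ([finite_crossings_locally_connected]).

    Strips of arbitrary direction are made vertical by a similarity of the plane
    ([turn]). The norm of the plane is the max norm, so balls are squares. *)

Set Implicit Arguments.
Unset Strict Implicit.
Unset Printing Implicit Defensive.

Import Order.TTheory GRing.Theory Num.Theory.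
Import numFieldNormedType.Exports.
Local Open Scope ring_scope.
Local Open Scope classical_set_scope.

(** * Compactness and chains in normed spaces *)

Section Metric.
Context {R : realType} {V : normedModType R}.
Implicit Types (x y z : V) (A B C D E F K N Z : set V) (e d : R).

Lemma nbhs_normP x (A : set V) :
  nbhs x A <-> exists2 e, 0 < e & forall y, `|x - y| < e -> A y.
Proof.
split=> [/nbhs_ballP[e /= e0 eA]|[e e0 eA]].
  by exists e => // y xy; apply: eA; rewrite -ball_normE.
by apply/nbhs_ballP; exists e => //= y; rewrite -ball_normE /=; exact: eA.
Qed.

Lemma closure_normP A x :
  closure A x <-> forall e, 0 < e -> exists2 y, A y & `|x - y| < e.
Proof.
split=> [Ax e e0|Ax B /nbhs_normP[e e0 eB]].
  have /Ax[y [Ay]] : nbhs x [set y | `|x - y| < e] by apply/nbhs_normP; exists e.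
  by exists y.
by have [y Ay xy] := Ax _ e0; exists y; split => //; exact: eB.
Qed.

Lemma closed_normP A :
  closed A <-> forall x, ~ A x -> exists2 e, 0 < e & forall y, A y -> e <= `|x - y|.
Proof.
split=> [cA x nAx|h x /closure_normP Ax].
  have /nbhs_normP[e e0 he] : nbhs x (~` A).
    by apply: open_nbhs_nbhs; split => //; exact: closed_openC.
  exists e => // y Ay; rewrite leNgt; apply/negP => xy.
  exact: he xy Ay.
apply: contrapT => /h[e e0 he]; have [y Ay] := Ax _ e0.
by rewrite ltNge he.
Qed.

(** The form of compactness used below: scales are chosen by the neighbourhood
    filter of 0 on the right, so no finite subcover has to be named. *)
Lemma compact_uniform_scale K (P : R -> V -> Prop) : compact K ->
  (forall x, K x -> exists2 e, 0 < e &
     forall y d, `|x - y| < e -> 0 < d -> d <= e -> P d y) ->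
  exists2 e, 0 < e & forall y, K y -> P e y.
Proof.
move=> /compact_near_coveringP cK h.
have : \forall e \near 0^'+, K `<=` P e.
  apply: cK => x /h[e e0 he].
  have : \forall y \near x & d \near 0^'+, `|x - y| < e /\ (0 < d /\ d <= e).
    exists ([set y | `|x - y| < e], [set d | 0 < d /\ d <= e]) => /=.
      split; first by apply/nbhs_normP; exists e.
      exists e => //= d /=; rewrite sub0r normrN => de d0; split => //.
      by rewrite ltW // (le_lt_trans (ler_norm _)).
    by move=> [y d] /= [].
  by apply: filterS => -[y d] /= [xy [d0 de]]; exact: he.
move=> [e /= e0 he]; exists (e / 2); first by rewrite divr_gt0.
apply: he => /=; last by rewrite divr_gt0.
by rewrite sub0r normrN gtr0_norm ?divr_gt0// ltr_pdivrMr // ltr_pMr // ltr1n.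
Qed.

Lemma compact_closed_dist K F : compact K -> closed F -> K `&` F = set0 ->
  exists2 e, 0 < e & forall x y, K x -> F y -> e <= `|x - y|.
Proof.
move=> cK /closed_normP cF KF.
have [|e e0 he] := compact_uniform_scale (P := fun e x => forall y, F y -> e <= `|x - y|) cK.
  move=> x Kx; have [|e e0 he] := cF x.
    by move=> Fx; have : (K `&` F) x by []; rewrite KF.
  exists (e / 2); first by rewrite divr_gt0.
  move=> y d xy d0 de z Fz; have := he z Fz.
  have := ler_distD y x z; lra.
by exists e => // x y Kx; exact: he.
Qed.

Lemma compact_nested K (G : R -> set V) : compact K ->
  (forall e, 0 < e -> closed (G e)) ->
  (forall e d, 0 < d -> d <= e -> G d `<=` G e) ->
  (forall e, 0 < e -> K `&` G e !=set0) ->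
  exists2 x, K x & forall e, 0 < e -> G e x.
Proof.
move=> cK cG mG nG; apply: contrapT => hno.
have [|e e0 he] := compact_uniform_scale (P := fun e x => ~ G e x) cK; last first.
  by have [x [Kx /he]] := nG _ e0; exact.
move=> x Kx.
have [e [e0 nGx]] : exists e, 0 < e /\ ~ G e x.
  apply: contrapT => hn; apply: hno; exists x => // e e0.
  by apply: contrapT => nG'; apply: hn; exists e.
have /closed_normP/(_ _ nGx)[d d0 hd] := cG _ e0.
exists (Num.min d e); first by rewrite lt_min d0.
move=> y r; rewrite lt_min le_min => /andP[xy _] r0 /andP[_ re] Gy.
by have := hd y (mG _ _ r0 re _ Gy); rewrite leNgt xy.
Qed.

(** Chains with steps smaller than [e] replace paths, which a connected set need
    not contain. The list form keeps the points in order, as the parity count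
    further down requires. *)
Definition chain A e x (s : seq V) :=
  path (fun u v => `|u - v| < e) x s /\ (forall u, u \in x :: s -> A u).

Definition chain_class A e x : set V :=
  [set y | exists2 s, chain A e x s & last x s = y].

Lemma chain_class_refl A e x : A x -> chain_class A e x x.
Proof. by move=> Ax; exists [::] => //; split => // u; rewrite inE => /eqP->. Qed.

Lemma chain_class_sub A e x : chain_class A e x `<=` A.
Proof. by move=> _ [s [_ h] <-]; apply: h; exact: mem_last. Qed.

Lemma chain_class_step A e x y z :
  chain_class A e x y -> A z -> `|y - z| < e -> chain_class A e x z.
Proof.
move=> [s [ps As] <-] Az yz; exists (rcons s z); last by rewrite last_rcons.
split; first by rewrite rcons_path ps.
by move=> u; rewrite -rcons_cons mem_rcons inE => /orP[/eqP->//|/As].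
Qed.

Lemma chain_class_incl A e d x : d <= e -> chain_class A d x `<=` chain_class A e x.
Proof.
move=> de _ [s [ps As] <-]; exists s => //; split => //.
by apply: sub_path ps => u v /lt_le_trans; apply.
Qed.

(** Induction along chains: a property that passes from each point of the chain
    class to its [e]-close neighbours in [A] holds on the whole class. *)
Lemma chain_class_ext (P : V -> Prop) A e x y : P x ->
  (forall u v, P u -> chain_class A e x u -> A v -> `|u - v| < e -> P v) ->
  chain_class A e x y -> P y.
Proof.
move=> Px h [s [ps As] <-].
elim/last_ind: s ps As => [//|s z IH].
rewrite rcons_path last_rcons => /andP[ps sz] As.
have As' u : u \in x :: s -> A u.
  by move=> us; apply: As; rewrite -rcons_cons mem_rcons inE us orbT.
apply: h sz; [exact: IH | by exists s |].
by apply: As; rewrite -rcons_cons mem_rcons inE eqxx.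
Qed.

(** Both a class and its complement in [A] are unions of parts lying at distance
    at least [e] from each other. *)
Lemma chain_class_clopen A e x : 0 < e -> closed A ->
  closed (chain_class A e x) /\ closed (A `\` chain_class A e x).
Proof.
move=> e0 cA; split=> y /closure_normP/[dup] Cy /(_ _ e0)[z].
  move=> Nz yz; apply: chain_class_step Nz _ _; last by rewrite distrC.
  apply: cA; apply/closure_normP => d d0; have [w /chain_class_sub ? ?] := Cy _ d0.
  by exists w.
move=> [Az nNz] yz; split.
  by apply: cA; apply/closure_normP => d d0; have [w [? _] ?] := Cy _ d0; exists w.
by move=> Ny; apply: nNz; exact: chain_class_step yz.
Qed.

Lemma connected_clopen C N : connected C -> closed N -> closed (C `\` N) ->
  C `&` N !=set0 -> C `<=` N.
Proof.
move=> cC cN cCN CN0; have <- : C `&` N = C; last by move=> ? [].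
apply: cC => //; last by exists N.
exists (~` (C `\` N)); first exact: closed_openC.
rewrite eqEsubset; split=> x [Cx]; first by move=> Nx; split => // -[].
by move=> h; split => //; apply: contrapT => nNx; apply: h.
Qed.

Lemma connected_chain C e x y : 0 < e -> connected C -> C x -> C y -> chain_class C e x y.
Proof.
move=> e0 cC Cx Cy.
suff E : chain_class C e x = C by rewrite E.
apply: cC; first by exists x; exact: chain_class_refl.
  exists (\bigcup_(u in chain_class C e x) ball u e).
    by apply: bigcup_open => u _; exact: ball_open.
  rewrite eqEsubset; split=> [u Cu|v [Cv [u Cu]]].
    split; first exact: chain_class_sub Cu.
    by exists u => //; exact: ballxx.
  by rewrite -ball_normE; exact: chain_class_step.
exists (~` \bigcup_(u in C `\` chain_class C e x) ball u e).
  by apply: open_closedC; apply: bigcup_open => u _; exact: ball_open.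
rewrite eqEsubset; split=> [v Cv|v [Cv nv]].
  split; first exact: chain_class_sub Cv.
  move=> [u [Cu nu]]; rewrite -ball_normE /= => uv; apply: nu.
  by apply: chain_class_step Cv Cu _; rewrite distrC.
apply: contrapT => nC; apply: nv; exists v => //; exact: ballxx.
Qed.

End Metric.

(** * Components of compact sets, and segments *)

Section Components.
Context {R : realType} {V : normedModType R}.
Implicit Types (x y z : V) (A B C D E F K N Z : set V) (e d : R).

Let chain_core K x : set V := [set y | forall e, 0 < e -> chain_class K e x y].

Lemma closed_compact_hausdorff K : compact K -> closed K.
Proof. by apply: compact_closed; exact: norm_hausdorff. Qed.

(** If the set of points chained to [x] at every scale split into two closed
    parts, every chain from one part to the other would have a point far from
    both; by compactness such points accumulate at a point of the set
    itself. *)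
Let chain_core_inseparable K x E F : compact K -> K x -> closed E -> closed F ->
  E `&` F = set0 -> chain_core K x = E `|` F -> E x -> F `<=` set0.
Proof.
move=> cK Kx cE cF EF ZE Ex y Fy.
have cK' := closed_compact_hausdorff cK.
have ZK : E `|` F `<=` K by rewrite -ZE => z /(_ 1 ltr01)/chain_class_sub.
have kE : compact E by apply: subclosed_compact cE cK _ => z Ez; apply: ZK; left.
have [r r0 hr] := compact_closed_dist kE cF EF.
pose far A := [set z | forall u, A u -> r / 3 <= `|u - z|].
have cfar A : closed (far A).
  apply/closed_normP => z /existsNP[u /not_implyP[Au /negP]]; rewrite -ltNge => uz.
  exists (r / 3 - `|u - z|); first by rewrite subr_gt0.
  move=> w /(_ _ Au) uw; have := ler_distD z u w; lra.
pose G e := chain_class K e x `&` (far E `&` far F).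
have [|||z Kz hz] := compact_nested (G := G) cK.
- move=> e e0; apply: closedI; first by case: (chain_class_clopen x e0 cK').
  exact: closedI.
- by move=> e d d0 de z [Nz fz]; split => //; exact: chain_class_incl Nz.
- move=> e e0; apply: contrapT => hn.
  pose d := Num.min e (r / 3).
  have d0 : 0 < d by rewrite lt_min e0 divr_gt0.
  pose P z := exists2 u, E u & `|u - z| < r / 3.
  (* with no chain point far from both parts, chains from x stay near E *)
  have Py : P y.
    apply: (@chain_class_ext _ _ P K d x); last first.
    - by have : chain_core K x y; [rewrite ZE; right | exact].
    - move=> u v [u' Eu' uu'] Nu Kv; rewrite lt_min => /andP[uve uvr].
      apply: contrapT => nPv; apply: hn; exists v; split => //; split.
        apply: (@chain_class_incl _ _ _ _ d); first by rewrite ge_min lexx.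
        by apply: chain_class_step Nu Kv _; rewrite lt_min uve.
      split=> w Aw; rewrite leNgt; apply/negP => wv.
        by apply: nPv; exists w.
      have := hr _ _ Eu' Aw; have := ler_distD u u' w; have := ler_distD v u w.
      by rewrite (distrC v w); lra.
    - by exists x => //; rewrite subrr normr0 divr_gt0.
  have [u Eu uy] := Py; have := hr _ _ Eu Fy; lra.
have : chain_core K x z by move=> e /hz[].
rewrite ZE => -[] Az; have [_ [fE fF]] := hz 1 ltr01.
  by have := fE _ Az; rewrite subrr normr0; lra.
by have := fF _ Az; rewrite subrr normr0; lra.
Qed.

Let chain_core_connected K x : compact K -> K x -> connected (chain_core K x).
Proof.
move=> cK Kx B [y By] [O oO BO] [D cD BD].
have cZ : closed (chain_core K x).
  apply/closed_normP => z /existsNP[e /not_implyP[e0 nz]].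
  have [cN _] := chain_class_clopen x e0 (closed_compact_hausdorff cK).
  have /closed_normP/(_ _ nz)[d d0 hd] := cN; exists d => // w /(_ _ e0); exact: hd.
have cB : closed B by rewrite BD; exact: closedI.
pose B' := chain_core K x `&` ~` O.
have cB' : closed B' by apply: closedI => //; exact: open_closedC.
have BB' : B `&` B' = set0.
  by rewrite -subset0 => z []; rewrite BO => -[_ ?] [].
have UB : chain_core K x = B `|` B'.
  by rewrite BO -setIUr setUCr setIT.
have Zx : chain_core K x x by move=> e e0; exact: chain_class_refl.
have [Bx|Bx] : B x \/ B' x by move: Zx; rewrite UB.
  by have := chain_core_inseparable cK Kx cB cB' BB' UB Bx; rewrite UB subset0 => ->; rewrite setU0.
rewrite setIC in BB'; rewrite setUC in UB.
by have := chain_core_inseparable cK Kx cB' cB BB' UB Bx By.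
Qed.

(** In a compact set the component of a point is the intersection of its chain
    classes, which are clopen; compactness then makes a single class miss a
    closed set that the component misses. *)
Lemma component_clopen_sep K x F : compact K -> K x -> closed F ->
  connected_component K x `&` F = set0 ->
  exists N, [/\ closed N, closed (K `\` N), N `<=` K,
    connected_component K x `<=` N & N `&` F = set0].
Proof.
move=> cK Kx cF CF; have cK' := closed_compact_hausdorff cK.
have [e e0 he] : exists2 e, 0 < e & chain_class K e x `&` F = set0.
  apply: contrapT => hn.
  have [|||z Kz hz] := compact_nested (G := fun e => chain_class K e x `&` F) cK.
  - by move=> e e0; apply: closedI => //; case: (chain_class_clopen x e0 cK').
  - by move=> e d d0 de z [Nz fz]; split => //; exact: chain_class_incl Nz.
  - move=> e e0; have [[z [Nz Fz]]|h] := pselect (chain_class K e x `&` F !=set0).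
      by exists z; split => //; exact: chain_class_sub Nz.
    exfalso; apply: hn; exists e => //; rewrite -subset0 => z hz; by apply: h; exists z.
  suff : (connected_component K x `&` F) z by rewrite CF.
  have Zz : chain_core K x z by move=> e /hz[].
  split; last by have [] := hz 1 ltr01.
  apply: (connected_component_max _ _ (chain_core_connected cK Kx)) Zz.
    by move=> e e0; exact: chain_class_refl.
  by move=> w /(_ 1 ltr01)/chain_class_sub.
have [cN cKN] := chain_class_clopen x e0 cK'.
exists (chain_class K e x); split => //; first exact: chain_class_sub.
move=> z Cz; have := @connected_chain _ _ _ _ x z e0 (@component_connected _ K x).
move=> /(_ (connected_component_refl Kx) Cz).
move=> [s [ps As] lz]; exists s => //; split => // u /As; exact: connected_component_sub.
Qed.

(** Boundary bumping: a component of the trace of a continuum on a closed set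
    cannot stay away from the rest of the continuum, since it would then be
    contained in a clopen part of the continuum. *)
Lemma boundary_bumping C E x : compact C -> connected C -> closed E -> C x -> E x ->
  ~ C `<=` E -> exists2 y, connected_component (C `&` E) x y & closure (C `\` E) y.
Proof.
move=> cC kC cE Cx Ex nCE; apply: contrapT => hn.
have cCE : compact (C `&` E).
  apply: (subclosed_compact _ cC); last by move=> z [].
  by apply: closedI => //; exact: closed_compact_hausdorff.
have CF : connected_component (C `&` E) x `&` closure (C `\` E) = set0.
  by rewrite -subset0 => y [? ?]; apply: hn; exists y.
have [N [cN cCN NC CN NF]] :=
  component_clopen_sep cCE (conj Cx Ex) (@closed_closure _ _) CF.
apply: nCE; suff : C `<=` N by move=> h z /h/NC[].
apply: connected_clopen => //.
  have -> : C `\` N = (C `&` E `\` N) `|` (closure (C `\` E) `&` C).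
    rewrite eqEsubset; split=> z.
      move=> [Cz nNz]; have [Ez|nEz] := pselect (E z); first by left.
      by right; split => //; apply: subset_closure.
    move=> [[[Cz Ez] nNz]|[Fz Cz]]; split => // Nz.
    by have : (N `&` closure (C `\` E)) z by []; rewrite NF.
  apply: closedU => //; apply: closedI; first exact: closed_closure.
  exact: closed_compact_hausdorff.
by exists x; split => //; apply: CN; exact: connected_component_refl.
Qed.

Lemma componentsP A B x : components A B -> B x -> B = connected_component A x.
Proof. by move=> [y Ay <-] /same_connected_component. Qed.

Lemma components_sub A B : components A B -> B `<=` A.
Proof. by move=> [y Ay <-]; exact: connected_component_sub. Qed.

Lemma components_connected A B : components A B -> connected B.
Proof. by move=> [y Ay <-]; exact: component_connected. Qed.

Lemma components_meet A B C D : components A B -> components A C ->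
  connected D -> D `<=` A -> B `&` D !=set0 -> C `&` D !=set0 -> B = C.
Proof.
move=> hB hC cD DA [x [Bx Dx]] [y [Cy Dy]].
rewrite (componentsP hB Bx) (componentsP hC Cy).
by apply: same_connected_component; exact: (connected_component_max Dx).
Qed.

Definition seg x y : set V := [set x + t *: (y - x) | t in `[0, 1]].

Lemma seg_l x y : seg x y x.
Proof. by exists 0; rewrite ?scale0r ?addr0//= in_itv /= lexx ler01. Qed.

Lemma seg_r x y : seg x y y.
Proof. by exists 1; [rewrite /= in_itv /= lexx ler01|rewrite scale1r addrC subrK]. Qed.

Lemma seg_continuous x y : continuous (fun t : R => x + t *: (y - x)).
Proof.
move=> t; apply: cvgD; first exact: cvg_cst.
by apply: cvgZl; exact: cvg_id.
Qed.

Lemma seg_connected x y : connected (seg x y).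
Proof.
apply: connected_continuous_connected; first exact: segment_connected.
by apply: continuous_subspaceT; exact: seg_continuous.
Qed.

Lemma seg_compact x y : compact (seg x y).
Proof.
apply: continuous_compact; last exact: segment_compact.
by apply: continuous_subspaceT; exact: seg_continuous.
Qed.

Definition seg_convex A := forall x y, A x -> A y -> seg x y `<=` A.

Lemma seg_convex_connected A : seg_convex A -> connected A.
Proof.
move=> hA; have [->|/set0P[x Ax]] := eqVneq A set0; first exact: connected0.
have -> : A = \bigcup_(y in A) seg x y.
  rewrite eqEsubset; split=> z.
    by move=> Az; exists z => //; exact: seg_r.
  by move=> [y Ay]; exact: hA.
apply: bigcup_connected; last by move=> *; exact: seg_connected.
by exists x => y _; exact: seg_l.
Qed.

Lemma seg_convex_ball x e : seg_convex (ball x e).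
Proof.
move=> y z; rewrite -ball_normE /= => xy xz _ [t /= + <-]; rewrite in_itv /= => /andP[t0 t1].
have -> : x - (y + t *: (z - y)) = (1 - t) *: (x - y) + t *: (x - z).
  have -> : z - y = (x - y) - (x - z) by rewrite opprB [RHS]addrC addrA subrK.
  by rewrite opprD addrA -scalerN opprB scalerBl scale1r scalerBr addrA addrAC.
apply: le_lt_trans (ler_normD _ _) _; rewrite !normrZ ger0_norm ?subr_ge0// ger0_norm//.
have [t1'|t1'] := ltP t 1.
  have : 0 < (1 - t) * (e - `|x - y|) by rewrite mulr_gt0 ?subr_gt0.
  have : 0 <= t * (e - `|x - z|) by rewrite mulr_ge0 // subr_ge0 ltW.
  lra.
have -> : t = 1 by apply/le_anti; rewrite t1.
by rewrite subrr mul0r add0r mul1r.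
Qed.

End Components.

(** * Continua in open sets, and finiteness criteria *)

Section Continua.
Context {R : realType} {V : normedModType R}.
Implicit Types (x y z : V) (A B C D E F G H K N Z : set V) (e d : R).

(** Crossing arguments need compact sets, so components of open sets are replaced
    by continua inside them. The points that such a continuum joins to [x]
    form a relatively clopen set, because small segments do not leave [B]. *)
Lemma component_continuum H K B x y : seg_convex H -> closed K ->
  components (H `\` K) B -> B x -> B y ->
  exists G, [/\ compact G, connected G, G `<=` B, G x & G y].
Proof.
move=> hH cK hB Bx By.
pose S := [set z | exists G, [/\ compact G, connected G, G `<=` B, G x & G z]].
have BH := components_sub hB.
have step z w r : B z -> B w -> ball z r `&` K = set0 -> ball z r w ->
  seg z w `<=` B.
  move=> Bz Bw zK zw; rewrite (componentsP hB Bz).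
  apply: connected_component_max; [exact: seg_l| |exact: seg_connected].
  move=> u zwu; split; first by case: (BH _ Bz) (BH _ Bw) => Hz _ [Hw _]; exact: (hH z w).
  move=> Ku; suff : (ball z r `&` K) u by rewrite zK.
  split => //; apply: (@seg_convex_ball _ _ z r z w) => //.
  have [r0|r0] := ltP 0 r; first exact: ballxx.
  by move: zw; rewrite -ball_normE /= => /(le_lt_trans (normr_ge0 _)); rewrite ltNge r0.
have clear z : B z -> exists2 r, 0 < r & ball z r `&` K = set0.
  move=> /BH[_]; have /closed_normP cK' := cK; move/cK' => [r r0 hr].
  exists r => //; rewrite -subset0 => w []; rewrite -ball_normE /= => zw /hr.
  by rewrite leNgt zw.
have ext z w : S z -> seg z w `<=` B -> S w.
  move=> [G [cG kG GB Gx Gz]] zwB; exists (G `|` seg z w); split.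
  - by apply: compactU => //; exact: seg_compact.
  - by apply: connectedU => //; [exists z; split => //; exact: seg_l|exact: seg_connected].
  - by rewrite subUset.
  - by left.
  - by right; exact: seg_r.
have SB z : S z -> B z by move=> [G [_ _ + _]]; apply.
have segC z w : seg z w = seg w z.
  have sub z' w' : seg z' w' `<=` seg w' z'.
    move=> _ [t /= + <-]; rewrite in_itv /= => /andP[t0 t1].
    exists (1 - t); first by rewrite /= in_itv /= subr_ge0 t1 /= lerBlDr lerDl.
    by rewrite scalerBl scale1r addrA [w' + (z' - w')]addrC subrK -scalerN opprB.
  by rewrite eqEsubset; split.
suff SE : S = B by have : S y by rewrite SE.
pose O (W : set V) :=
  \bigcup_(p in [set p : V * R | W p.1 /\ ball p.1 p.2 `&` K = set0]) ball p.1 p.2.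
have oO W : open (O W) by apply: bigcup_open => u _; exact: ball_open.
apply: (@components_connected _ _ _ B hB).
- exists x; exists [set x]; split => //;
    [exact: (@compact_set1 _ x)|exact: (@connected1 _ x)|by move=> _ ->].
- exists (O S) => //; rewrite eqEsubset; split=> [z Sz|w [Bw [[z r] /= [Sz zK] zw]]].
    split; first exact: SB.
    by have [r r0 zK] := clear _ (SB _ Sz); exists (z, r) => //; exact: ballxx.
  by apply: (ext _ _ Sz); apply: (step _ _ r) => //; exact: SB.
- exists (~` O (B `\` S)); first exact: open_closedC.
  rewrite eqEsubset; split=> [w Sw|z [Bz nO]].
    split; first exact: SB.
    move=> [[z r] /= [[Bz nSz] zK] zw]; apply: nSz; 
    by apply: (ext _ _ Sw); rewrite segC; apply: (step _ _ r) => //; exact: SB.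
  apply: contrapT => nSz; apply: nO; have [r r0 zK] := clear _ Bz.
  by exists (z, r) => //; exact: ballxx.
Qed.

(** [k] is the point of [K] on the segment that comes first when one starts at
    [x]; a point of the segment up to [k] is then either in [K] or joined to
    [x] outside [K]. *)
Lemma first_hit K x y : closed K -> seg x y `&` K !=set0 ->
  exists k, [/\ K k, seg x y k & forall u, seg x k u -> ~ K u -> seg x u `&` K = set0].
Proof.
move=> cK [_ [[t0 t0i <-] Kt0]].
pose g (t : R) := x + t *: (y - x).
pose A := `[(0:R), 1] `&` g @^-1` K.
have cA : compact A.
  apply: compact_closedI; first exact: segment_compact.
  by apply: preimage_closed => // t _; exact: seg_continuous.
have [t tA tmin] : exists2 t, t \in A & forall s, s \in A -> t <= s.
  apply: (@compact_EVT_min _ R id A _ cA); first by exists t0.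
  by apply: continuous_subspaceT => u; exact: cvg_id.
move/set_mem : tA => [ti Kt]; exists (g t); split => //; first by exists t.
move=> _ [s /= + <-] nKs; rewrite in_itv /= => /andP[s0 s1].
rewrite -subset0 => _ [[s' /= + <-]]; rewrite in_itv /= => /andP[s'0 s'1].
move: ti nKs; rewrite /= in_itv /= => /andP[t0' t1].
rewrite /g ![x + _ - x]addrAC subrr !add0r !scalerA => nKst Kst.
have /tmin tst : s' * s * t \in A.
  by apply/mem_set; split => //=; rewrite in_itv /= !mulr_ge0 // !mulr_ile1 // mulr_ge0.
apply: nKst; suff -> : s * t = t by [].
have sst : s' * s * t <= s * t by rewrite -mulrA ler_piMl // mulr_ge0.
by apply/le_anti; rewrite ler_piMl //= (le_trans tst).
Qed.

(** A finite subcover of [K] by the given balls leaves finitely many members of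
    the family. *)
Lemma locally_finite_family K (S : set (set V)) : compact K ->
  (forall x, K x -> exists2 e, 0 < e &
    finite_set [set D | S D /\ D `&` ball x e !=set0]) ->
  (forall D, S D -> D `&` K !=set0) -> finite_set S.
Proof.
move=> cK h hS.
have /choice[e he] x : exists e, K x -> 0 < e /\
    finite_set [set D | S D /\ D `&` ball x e !=set0].
  have [Kx|nKx] := pselect (K x); last by exists 0.
  by have [e e0 fe] := h _ Kx; exists e.
move: cK; rewrite compact_cover => /(_ V K (fun x => ball x (e x))) [].
- by move=> x _; exact: ball_open.
- by move=> x Kx; exists x => //; apply: ballxx; have [] := he _ Kx.
move=> D DK cov.
apply: (@sub_finite_set _ S (\bigcup_(x in [set` D]) [set B | S B /\ B `&` ball x (e x) !=set0])).
  move=> B SB; have [z [Bz Kz]] := hS _ SB.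
  by have [x xD xz] := cov _ Kz; exists x => //; split => //; exists z.
apply: bigcup_finite; first exact: finite_fset.
by move=> x /= /DK/set_mem /he[].
Qed.

End Continua.

(** Three elements of a set can always be listed in increasing order of an
    injective real function, so excluding such triples leaves at most two
    elements. *)
Lemma no_increasing_triple_finite (R : realType) T (S : set T) (f : T -> R) :
  (forall x y, S x -> S y -> f x = f y -> x = y) ->
  (forall x y z, S x -> S y -> S z -> f x < f y -> f y < f z -> False) ->
  finite_set S.
Proof.
move=> fi h; apply: contrapT => Sinf.
have grow A : finite_set A -> exists2 x, S x & ~ A x.
  move=> fA; apply: contrapT => hn; apply/Sinf/(sub_finite_set _ fA) => x Sx.
  by apply: contrapT => nAx; apply: hn; exists x.
have [x Sx _] := grow _ (finite_set0 T).
have [y Sy yx] := grow _ (finite_set1 x).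
have [z Sz zxy] := grow _ (finite_set2 x y).
case: (ltgtP (f x) (f y)) => [xy|xy|/fi]; last by move=> xy; apply: yx; rewrite /= xy.
- case: (ltgtP (f z) (f x)) => [zx|zx|/fi]; last by move=> zx; apply: zxy; left; exact: zx.
    exact: (h z x y).
  case: (ltgtP (f z) (f y)) => [zy|zy|/fi]; last by move=> zy; apply: zxy; right; exact: zy.
    exact: (h x z y).
  exact: (h x y z).
- case: (ltgtP (f z) (f y)) => [zy|zy|/fi]; last by move=> zy; apply: zxy; right; exact: zy.
    exact: (h z y x).
  case: (ltgtP (f z) (f x)) => [zx|zx|/fi]; last by move=> zx; apply: zxy; left; exact: zx.
    exact: (h y z x).
  exact: (h y x z).
Qed.

(** * Continua in the plane do not cross *)

Section Plane.
Context {R : realType}.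
Implicit Types (p q u v w z : R * R) (A B C D E F G H K N P Q Z : set (R * R)).
Implicit Types (a b c d e r x y : R).

Lemma pair_normE u : `|u| = Num.max `|u.1| `|u.2|.
Proof. by []. Qed.

Lemma pair_norm_lt u e : `|u| < e = (`|u.1| < e) && (`|u.2| < e).
Proof. by rewrite pair_normE gt_max. Qed.

Lemma pair_norm_ge u e : e <= `|u| = (e <= `|u.1|) || (e <= `|u.2|).
Proof. by rewrite pair_normE le_max. Qed.

Lemma pair_norm_le u e : `|u| <= e = (`|u.1| <= e) && (`|u.2| <= e).
Proof. by rewrite pair_normE ge_max. Qed.

(** The parity of the number of steps of the chain [q :: qs] that cross the
    horizontal ray issued from [p] to the right. A step is charged to the
    abscissa of its initial point: this is harmless when the steps are short
    compared with the distance from [p] to the chain, and it keeps the count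
    Boolean. *)
Fixpoint crossings p q (qs : seq (R * R)) : bool :=
  if qs is q' :: qs' then
    (((q.2 <= p.2) (+) (q'.2 <= p.2)) && (p.1 < q.1)) (+) crossings p q' qs'
  else false.

(** For the max norm, a point far from [p] in the plane and close to it in one
    coordinate is far from it in the other. *)
Definition far e p q := 2 * e <= `|q - p|.

Lemma far_horizontal e p q r s : far e p q -> `|q.1 - p.1| < e ->
  `|r - q.2| < e -> `|s - p.2| < e -> (r <= s) = (q.2 <= p.2).
Proof.
rewrite /far pair_norm_ge => /orP[] /= h1 h2 h3 h4.
  exfalso; have := normr_ge0 (q.1 - p.1); lra.
move: h1 h3 h4; rewrite ler_normr !ltr_norml => /orP[] h1 /andP[h3 h5] /andP[h4 h6].
  by apply/idP/idP => ?; lra.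
by apply/idP/idP => ?; lra.
Qed.

Lemma far_vertical e p q r s : far e p q -> `|q.2 - p.2| < e ->
  `|r - q.1| < e -> `|s - p.1| < e -> (s < r) = (p.1 < q.1).
Proof.
rewrite /far pair_norm_ge => /orP[] /= h1 h2 h3 h4; last first.
  exfalso; have := normr_ge0 (q.2 - p.2); lra.
move: h1 h3 h4; rewrite ler_normr !ltr_norml => /orP[] h1 /andP[h3 h5] /andP[h4 h6].
  by apply/idP/idP => ?; lra.
by apply/idP/idP => ?; lra.
Qed.

Lemma between_close e x y r : `|x - y| < e -> (x < r) != (y < r) -> `|r - x| < e.
Proof.
rewrite !ltr_norml => /andP[h1 h2].
by case: (ltP x r) => a; case: (ltP y r) => b //= _; apply/andP; split; lra.
Qed.

(** Moving [p] by less than one step changes the parity only through the ends of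
    the chain. Where the two base points lie on different sides of the
    abscissa of a point of the chain, this point is close in abscissa, hence
    far in ordinate, and the step from it crosses neither ray. Everywhere else
    the difference of the two counts is a telescoping sum. *)
Lemma crossings_step e p p' q (qs : seq (R * R)) :
  (forall u, u \in q :: qs -> far e p u) -> `|p - p'| < e ->
  path (fun u v => `|u - v| < e) q qs ->
  let t u := (u.2 <= p.2) (+) (u.2 <= p'.2) in
  crossings p q qs (+) crossings p' q qs =
  (t q && (p.1 < q.1)) (+) (t (last q qs) && (p.1 < (last q qs).1)).
Proof.
move=> + pp' + t; have e0 : 0 < e by exact: le_lt_trans (normr_ge0 _) pp'.
elim: qs q => [|q' qs IH] q hfar /=; first by rewrite !addbb.
move=> /andP[qq' pqs].
have /IH/(_ pqs) IHq : forall u, u \in q' :: qs -> far e p u.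
  by move=> u us; apply: hfar; rewrite inE us orbT.
have fq : far e p q by apply: hfar; rewrite inE eqxx.
have fq' : far e p q' by apply: hfar; rewrite !inE eqxx orbT.
move: qq' (pp'); rewrite !pair_norm_lt /= => /andP[qq1 qq2] /andP[pp1 pp2].
have z0 (x : R) : `|x - x| < e by rewrite subrr normr0.
have F1 : (p.1 < q.1) != (p'.1 < q.1) ->
  [/\ (q'.2 <= p.2) = (q.2 <= p.2), (q.2 <= p'.2) = (q.2 <= p.2) &
      (q'.2 <= p'.2) = (q.2 <= p.2)].
  move=> /(between_close pp1) h1.
  split; apply: (far_horizontal fq h1) => //; rewrite distrC //.
have F2 : (q'.2 <= p.2) != (q'.2 <= p'.2) -> (p.1 < q.1) = (p.1 < q'.1).
  rewrite !leNgt (inj_eq negb_inj) => /(between_close pp2) h1.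
  exact: (far_vertical fq' h1 qq1 (z0 p.1)).
rewrite addbACA IHq addbA; congr (_ (+) _); move: F1 F2; rewrite /t.
case: (p.1 < q.1); case: (p'.1 < q.1); case: (q.2 <= p.2); case: (q'.2 <= p.2);
case: (q.2 <= p'.2); case: (q'.2 <= p'.2); case: (p.1 < q'.1) => //= F1 F2;
by [case: (F1 isT)|have := F2 isT].
Qed.

(** From the left edge the ray sees every change of side of the chain, so the
    count only depends on the two ends. *)
Lemma crossings_left e a y q (qs : seq (R * R)) :
  (forall u, u \in q :: qs -> far e (a, y) u /\ a <= u.1) ->
  path (fun u v => `|u - v| < e) q qs ->
  crossings (a, y) q qs = (q.2 <= y) (+) ((last q qs).2 <= y).
Proof.
elim: qs q => [|q' qs IH] q hfar /=; first by rewrite addbb.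
move=> /andP[qq' pqs]; rewrite {}IH //; last first.
  by move=> u us; apply: hfar; rewrite inE us orbT.
have [fq aq] : far e (a, y) q /\ a <= q.1 by apply: hfar; rewrite inE eqxx.
move: qq'; rewrite pair_norm_lt /= => /andP[_ qq2].
have F : (q.2 <= y) != (q'.2 <= y) -> a < q.1.
  rewrite !leNgt (inj_eq negb_inj) => h.
  have {}h : `|q.2 - y| < e.
    move: qq2 h; rewrite !ltr_norml => /andP[h1 h2].
    by case: (ltP y q.2) => ?; case: (ltP y q'.2) => ? //= _; apply/andP; split; lra.
  have := normr_ge0 (q.2 - y).
  by move: fq; rewrite /far pair_norm_ge /= ler_normr => /orP[/orP[]|]; lra.
move: F; case: (q.2 <= y); case: (q'.2 <= y); case: (_ <= y); case: (a < q.1) => //= F;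
  by have := F isT.
Qed.

Lemma crossings_right p q (qs : seq (R * R)) :
  (forall u, u \in q :: qs -> u.1 <= p.1) -> crossings p q qs = false.
Proof.
elim: qs q => [//|q' qs IH] q h /=; rewrite IH; last first.
  by move=> u us; apply: h; rewrite inE us orbT.
by rewrite ltNge h ?inE ?eqxx// andbF.
Qed.

(** Conditions under which the boundary terms of [crossings_step] vanish at [z]
    for all base points in [P], when [P] is to the right of the abscissa
    [a]. *)
Definition outer_end a P z :=
  [\/ z.1 = a, forall w, P w -> w.2 < z.2 | forall w, P w -> z.2 <= w.2].

(** Two continua that cross must meet. The continuum [P] joins the left edge at
    height [y] to a point to the right of all of [D]. The parity of the
    crossings of a chain of [D] by rays issued from points of [P] is constant
    along [P]; it is even at the right end of [P], and at the left end it
    tells whether the ends of the chain lie on different sides of [y]. *)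
Lemma same_side a y P D z0 z1 : compact P -> connected P -> compact D -> connected D ->
  P `&` D = set0 -> (forall z, P z \/ D z -> a <= z.1) -> P (a, y) ->
  (exists2 w, P w & forall z, D z -> z.1 <= w.1) ->
  D z0 -> D z1 -> outer_end a P z0 -> outer_end a P z1 ->
  (z0.2 <= y) = (z1.2 <= y).
Proof.
move=> cP kP cD kD PD aPD Pay [w Pw wD] Dz0 Dz1 e0 e1.
have [r r0 hr] := compact_closed_dist cP (closed_compact_hausdorff cD) PD.
have r20 : 0 < r / 2 by rewrite divr_gt0.
have [qs [pqs Dqs] lqs] := connected_chain r20 kD Dz0 Dz1.
have farP u : P u -> forall q, q \in z0 :: qs -> far (r / 2) u q.
  by move=> Pu q /Dqs Dq; rewrite /far distrC mulrC divfK ?pnatr_eq0//; exact: hr.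
suff : crossings w z0 qs = crossings (a, y) z0 qs.
  rewrite crossings_right; last by move=> q /Dqs; exact: wD.
  rewrite (@crossings_left (r / 2)) //; last first.
    by move=> u us; split; [exact: farP|apply: aPD; right; exact: Dqs].
  by rewrite lqs; case: (z0.2 <= y); case: (z1.2 <= y).
have cw := connected_chain r20 kP Pay Pw.
apply: (@chain_class_ext _ _ (fun u => crossings u z0 qs = crossings (a, y) z0 qs)
  P (r / 2) (a, y)) cw => // u v <- /chain_class_sub Pu Pv uv.
(* both boundary terms of the parity count vanish *)
have off z : outer_end a P z ->
    ((z.2 <= u.2) (+) (z.2 <= v.2)) && (u.1 < z.1) = false.
  case=> [->|h|h]; last by rewrite !h.
    by rewrite ltNge aPD ?andbF//; left.
  by rewrite !leNgt !h.
have := crossings_step (farP _ Pu) uv pqs; rewrite /= lqs !off //=.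
by case: (crossings u _ _); case: (crossings v _ _).
Qed.

End Plane.

(** * Crossings in the complement of two disjoint closed sets *)

Lemma addb_telescope (f : nat -> bool) n :
  \big[addb/false]_(0 <= j < n) (f j (+) f j.+1) = f 0 (+) f n.
Proof.
elim: n => [|n IH]; first by rewrite big_geq// addbb.
by rewrite big_nat_recr//= IH addbA -(addbA (f 0)) addbb addbF.
Qed.

(** Colour the vertices of an n by n grid so that the bottom and top rows have
    colour [false], and call an edge with ends of two colours a door. A cell
    has an even number of doors. If [w] selects cells in such a way that two
    cells sharing a door are selected together, then the doors inside the
    selected region are counted twice, so the region has as many doors on the
    left side as on the right side modulo 2. Here [w i j] is attached to the
    lower left corner of the cell. *)
Lemma grid_parity n (col w : nat -> nat -> bool) :
  (forall i j, (i < n)%N -> (j < n)%N ->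
     ~~ [&& col i j == col i.+1 j, col i j == col i j.+1 & col i j == col i.+1 j.+1] ->
     w i j = w i.+1 j /\ w i j = w i j.+1) ->
  (forall i, (i <= n)%N -> col i 0 = false /\ col i n = false) ->
  let door i := \big[addb/false]_(0 <= j < n) (w i j && (col i j (+) col i j.+1)) in
  door 0 = door n.
Proof.
move=> hw hcol door.
suff doorS i : (i < n)%N -> door i = door i.+1.
  have : forall k, (k <= n)%N -> door 0 = door k; last by apply.
  by elim=> [//|k IH] kn; exact: etrans (IH (ltnW kn)) (doorS _ kn).
move=> ilt; suff : door i (+) door i.+1 = false by case: (door i); case: (door i.+1).
rewrite /door -big_split /=.
(* by evenness, vertical doors of a selected cell can be traded for horizontal ones *)
rewrite (@eq_big_nat _ _ _ _ _ _ (fun j => (w i j && (col i j (+) col i.+1 j)) (+)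
  (w i j.+1 && (col i j.+1 (+) col i.+1 j.+1)))).
  rewrite (addb_telescope (fun j => w i j && (col i j (+) col i.+1 j))).
  have [h1 h2] := hcol i (ltnW ilt); have [h3 h4] := hcol i.+1 ilt.
  by rewrite h1 h2 h3 h4 !andbF.
move=> j /andP[_ jn]; have := hw i j ilt jn.
case: (col i j); case: (col i.+1 j); case: (col i j.+1); case: (col i.+1 j.+1);
by case: (w i j); case: (w i.+1 j); case: (w i j.+1) => //= /(_ isT) [].
Qed.

Section Separation.
Context {R : realType}.
Implicit Types (p q u v w z : R * R) (A B C D E F G H K N P Q Z : set (R * R)).
Implicit Types (a b c d e r x y : R).

Lemma closed_coord (f : R * R -> R) :
  continuous f -> (forall x, closed [set z | f z <= x]) /\ (forall x, closed [set z | x <= f z]).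
Proof.
move=> fc; split=> x.
  exact: (preimage_closed (D := [set y | y <= x]) (fun z _ => fc z) (@closed_le _ x)).
exact: (preimage_closed (D := [set y | x <= y]) (fun z _ => fc z) (@closed_ge _ x)).
Qed.

Lemma fst_cts : continuous (fst : R * R -> R).
Proof. by move=> z; exact: cvg_fst. Qed.

Lemma snd_cts : continuous (snd : R * R -> R).
Proof. by move=> z; exact: cvg_snd. Qed.

Definition box a b c d : set (R * R) := `[a, b] `*` `[c, d].

Lemma boxE a b c d z : box a b c d z <-> [/\ a <= z.1, z.1 <= b, c <= z.2 & z.2 <= d].
Proof.
rewrite /box /= !in_itv /=; split=> [[/andP[-> ->] /andP[-> ->]]//|[-> -> -> ->]//].
Qed.

Lemma box_compact a b c d : compact (box a b c d).
Proof. by apply: compact_setX; exact: segment_compact. Qed.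

Lemma seg_coord u v z : seg u v z -> exists t, [/\ 0 <= t, t <= 1,
  z.1 = (1 - t) * u.1 + t * v.1 & z.2 = (1 - t) * u.2 + t * v.2].
Proof.
move=> [t /= + <-]; rewrite in_itv /= => /andP[t0 t1]; exists t; split => //=.
  by rewrite /GRing.scale /=; ring.
by rewrite /GRing.scale /=; ring.
Qed.

Lemma convex_comb_le t x y r : 0 <= t -> t <= 1 -> x <= r -> y <= r ->
  (1 - t) * x + t * y <= r.
Proof. by move=> *; nra. Qed.

Lemma convex_comb_ge t x y r : 0 <= t -> t <= 1 -> r <= x -> r <= y ->
  r <= (1 - t) * x + t * y.
Proof. by move=> *; nra. Qed.

Lemma seg_convex_box a b c d : seg_convex (box a b c d).
Proof.
move=> u v /boxE[u1 u2 u3 u4] /boxE[v1 v2 v3 v4] z /seg_coord[t [t0 t1 z1 z2]].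
by apply/boxE; rewrite z1 z2; split; do [exact: convex_comb_le|exact: convex_comb_ge].
Qed.

Lemma box_connected a b c d : connected (box a b c d).
Proof. exact/seg_convex_connected/seg_convex_box. Qed.

(** Colour the points that are near [A]. Along the left edge the colour changes an
    odd number of times between the point [(a, y1)] of [B] and the point [(a,
    y2)] of [A]. Cells with a door contain points near [A] and points not near
    it, hence avoid [A] and [B]. Select the cells reachable in the complement
    of [A] and [B] from the left edge between [y1] and [y2]. If no reachable
    point were on the right edge, or on the left edge outside the interval,
    the selected region would have an odd number of doors on the left side and
    none on the right side, contrary to [grid_parity]. *)
Lemma crossing_between a b c d y1 y2 A B : a < b ->
  compact A -> closed B -> A `&` B = set0 ->
  c <= y1 -> y1 < y2 -> y2 <= d -> B (a, y1) -> A (a, y2) ->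
  (forall z, A z -> c < z.2 < d) ->
  exists G, [/\ compact G, connected G, G `<=` box a b c d `\` (A `|` B),
    exists2 y, G (a, y) & y1 < y < y2 &
    (exists y, G (b, y)) \/ (exists2 y, G (a, y) & ~ y1 < y < y2)].
Proof.
move=> ab cA cB AB cy1 y12 y2d By1 Ay2 Acd; apply: contrapT => noG.
(* the top and bottom sides are kept away from A together with B *)
pose F := B `|` ([set z | z.2 <= c] `|` [set z | d <= z.2]).
have cF : closed F.
  have [h1 h2] := closed_coord snd_cts.
  by apply: closedU => //; apply: closedU.
have AF : A `&` F = set0.
  rewrite -subset0 => z [Az [Bz|[|]/=]]; first by rewrite -AB.
    by have /andP[] := Acd _ Az; rewrite leNgt => ->.
  by have /andP[_] := Acd _ Az; rewrite leNgt => ->.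
have [e e0 he] := compact_closed_dist cA cF AF.
pose r := e / 4; have r0 : 0 < r by rewrite divr_gt0.
have heB u v : A u -> B v -> 4 * r <= `|u - v|.
  by move=> Au Bv; rewrite mulrC divfK ?pnatr_eq0//; apply: he => //; left.
pose near z := exists2 u, A u & `|u - z| < 2 * r.
pose reach z := exists G, [/\ compact G, connected G, G `<=` box a b c d `\` (A `|` B),
  G z & exists2 y, G (a, y) & y1 < y < y2].
have reach_right y : ~ reach (b, y).
  by move=> [G [cG kG GT Gb Ga]]; apply: noG; exists G; split => //; left; exists y.
have reach_left y : reach (a, y) -> y1 < y < y2.
  move=> [G [cG kG GT Gb Ga]]; apply: contrapT => ny.
  by apply: noG; exists G; split => //; right; exists y.
have cd : c < d by lra.
(* a grid whose cells have diameter less than r *)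
have [n n0 hn] : exists2 n, (0 < n)%N & (b - a) / n%:R < r /\ (d - c) / n%:R < r.
  pose m := Num.max ((b - a) / r) ((d - c) / r).
  have m0 : 0 <= m by rewrite le_max divr_ge0 // ?ltW// subr_gt0.
  exists (Num.bound m) => //.
  have := archi_boundP m0; rewrite gt_max => /andP[h1 h2].
  have n0 : 0 < (Num.bound m)%:R :> R by exact: le_lt_trans m0 (archi_boundP m0).
  by split; rewrite ltr_pdivrMr // mulrC -ltr_pdivrMr.
have n0' : n%:R != 0 :> R by rewrite pnatr_eq0 -lt0n.
pose X i : R := a + (b - a) / n%:R * i%:R; pose Y j : R := c + (d - c) / n%:R * j%:R.
have X0 : X 0 = a by rewrite /X mulr0 addr0.
have Xn : X n = b by rewrite /X divfK // addrC subrK.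
have Y0 : Y 0 = c by rewrite /Y mulr0 addr0.
have Yn : Y n = d by rewrite /Y divfK // addrC subrK.
have stepX0 : 0 < (b - a) / n%:R by rewrite divr_gt0 ?subr_gt0 // ltr0n.
have stepY0 : 0 < (d - c) / n%:R by rewrite divr_gt0 ?subr_gt0 // ltr0n.
have XS i : X i.+1 = X i + (b - a) / n%:R by rewrite /X -natr1 mulrDr mulr1 addrA.
have YS i : Y i.+1 = Y i + (d - c) / n%:R by rewrite /Y -natr1 mulrDr mulr1 addrA.
have Xle i j : (i <= j)%N -> X i <= X j.
  by move=> ij; rewrite lerD2l ler_pM2l // ler_nat.
have Yle i j : (i <= j)%N -> Y i <= Y j.
  by move=> ij; rewrite lerD2l ler_pM2l // ler_nat.
move: hn => [hX hY].
pose cell i j := box (X i) (X i.+1) (Y j) (Y j.+1).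
have cellT i j : (i < n)%N -> (j < n)%N -> cell i j `<=` box a b c d.
  move=> ilt jlt z /boxE[h1 h2 h3 h4]; apply/boxE.
  have := Xle 0%N i isT; have := Xle _ _ ilt; have := Yle 0%N j isT; have := Yle _ _ jlt.
  by rewrite X0 Xn Y0 Yn; split; lra.
have cell_small i j u v : cell i j u -> cell i j v -> `|u - v| < r.
  move=> /boxE[+ + + +] /boxE[]; rewrite XS YS pair_norm_lt /= !ltr_norml => *.
  by apply/andP; split; apply/andP; split; lra.
have mixed_cell i j u v : (i < n)%N -> (j < n)%N -> cell i j u -> cell i j v ->
    near u -> ~ near v -> cell i j `<=` box a b c d `\` (A `|` B).
  move=> ilt jlt cu cv [s As su] nv w cw; split; first exact: cellT cw.
  move=> [Aw|Bw].
    apply: nv; exists w => //; apply: lt_trans (cell_small _ _ _ _ cw cv) _; lra.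
  have := heB _ _ As Bw; have := cell_small _ _ _ _ cu cw.
  by have := ler_distD u s w; lra.
have corner i j k l : (k <= 1)%N -> (l <= 1)%N -> cell i j (X (i + k)%N, Y (j + l)%N).
  by move=> k1 l1; apply/boxE; split; rewrite /=; (apply: Xle || apply: Yle);
    first [exact: leq_addr|by rewrite -addn1 leq_add2l].
pose col i j := `[< near (X i, Y j) >].
pose wr i j := `[< reach (X i, Y j) >].
have mixed i j : (i < n)%N -> (j < n)%N ->
    ~~ [&& col i j == col i.+1 j, col i j == col i j.+1 & col i j == col i.+1 j.+1] ->
    cell i j `<=` box a b c d `\` (A `|` B).
  move=> ilt jlt.
  have c00 := corner i j 0%N 0%N isT isT; have c01 := corner i j 0%N 1%N isT isT.
  have c10 := corner i j 1%N 0%N isT isT; have c11 := corner i j 1%N 1%N isT isT.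
  rewrite !(addn0, addn1) in c00 c01 c10 c11.
  have key u v : cell i j u -> cell i j v -> `[< near u >] != `[< near v >] ->
      cell i j `<=` box a b c d `\` (A `|` B).
    move=> cu cv; have [nu|nu] := asboolP (near u); have [nv|nv] := asboolP (near v) => // _.
      exact: mixed_cell cu cv nu nv.
    exact: mixed_cell cv cu nv nu.
  by rewrite !negb_and => /or3P[] h;
    [exact: (key _ _ c00 c10 h)|exact: (key _ _ c00 c01 h)|exact: (key _ _ c00 c11 h)].
have reach_cell i j u v : cell i j `<=` box a b c d `\` (A `|` B) ->
    cell i j u -> cell i j v -> reach u -> reach v.
  move=> cT cu cv [G [cG kG GT Gu [y Gy yy]]]; exists (G `|` cell i j); split.
  - by apply: compactU => //; exact: box_compact.
  - by apply: connectedU => //; [exists u|exact: box_connected].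
  - by rewrite subUset.
  - by right.
  - by exists y => //; left.
have parity := @grid_parity n col wr.
have {}parity : \big[addb/false]_(0 <= j < n) (wr 0 j && (col 0 j (+) col 0 j.+1)) =
    \big[addb/false]_(0 <= j < n) (wr n j && (col n j (+) col n j.+1)).
  apply: parity.
    move=> i j ilt jlt /(mixed _ _ ilt jlt) cT.
    have c00 := corner i j 0%N 0%N isT isT; have c01 := corner i j 0%N 1%N isT isT.
    have c10 := corner i j 1%N 0%N isT isT.
    rewrite !(addn0, addn1) in c00 c01 c10.
    by split; apply: asbool_equiv_eq; split; exact: (reach_cell i j _ _ cT).
  move=> i _; rewrite /col Y0 Yn.
  have off u v : A u -> F v -> 2 * r <= `|u - v|.
    by move=> Au Fv; have := he _ _ Au Fv; rewrite /r; lra.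
  split; apply/asboolP => -[u Au]; rewrite ltNge off //; right; [left|right] => /=; exact: lexx.
move: parity; rewrite [RHS]big1_seq; last first.
  move=> j _; rewrite /wr Xn; case: asboolP => //= /reach_right //.
(* the colour, normalised to change exactly where the selected doors are *)
pose g k := if Y k <= y1 then false else if Y k < y2 then col 0%N k else true.
have far1 y : `|y - y1| < r -> `[< near (a, y) >] = false.
  move=> yy; apply/asboolP => -[u Au uy]; have := heB _ _ Au By1.
  have : `|(a, y) - (a, y1)| < r by rewrite pair_norm_lt /= subrr normr0 r0.
  by have := ler_distD (a, y) u (a, y1); lra.
have near2 y : `|y - y2| < r -> `[< near (a, y) >] = true.
  move=> yy; apply/asboolP; exists (a, y2) => //.
  by rewrite pair_norm_lt /= subrr normr0 distrC; apply/andP; split; lra.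
have y12r : r < y2 - y1.
  have := heB _ _ Ay2 By1; rewrite pair_norm_ge /= subrr normr0 ger0_norm; last lra.
  by case/orP; lra.
rewrite (@eq_big_nat _ _ _ _ _ _ (fun j => g j (+) g j.+1)); last first.
  move=> j /andP[_ jn].
  have Yj : Y j.+1 - Y j < r /\ Y j < Y j.+1 by rewrite YS; split; lra.
  rewrite /wr /col X0 /g; have [h1|h1] := leP (Y j) y1.
    have -> : `[< reach (a, Y j) >] = false by apply/asboolP => /reach_left; lra.
    have [h2|h2] := leP (Y j.+1) y1 => //.
    rewrite ifT; last lra.
    by rewrite /= /col X0 far1 // ger0_norm; lra.
  have [h2|h2] := leP (Y j.+1) y1; first by lra.
  have [h3|h3] := ltP (Y j) y2; last first.
    have -> : `[< reach (a, Y j) >] = false by apply/asboolP => /reach_left; lra.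
    by rewrite ifF //; apply/negbTE; rewrite -leNgt; lra.
  have -> : (if Y j.+1 < y2 then col 0%N j.+1 else true) = `[< near (a, Y j.+1) >].
    have [h4|h4] := ltP (Y j.+1) y2; first by rewrite /col X0.
    by rewrite near2 // ger0_norm; lra.
  rewrite /col X0; set p := `[< near _ >]; set q := `[< near _ >].
  have [->|pq] := eqVneq p q; first by rewrite addbb andbF.
  suff -> : `[< reach (a, Y j) >] by [].
  have n00 : (0 < n)%N by exact: leq_ltn_trans jn.
  have cT : cell 0 j `<=` box a b c d `\` (A `|` B).
    apply: mixed => //; rewrite /col X0.
    by rewrite -/p -/q (negbTE pq) andbF.
  apply/asboolP; exists (cell 0 j); split.
  - exact: box_compact.
  - exact: box_connected.
  - exact: cT.
  - by have := corner 0 j 0%N 0%N isT isT; rewrite !addn0 X0.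
  - exists (Y j); last by rewrite h1 h3.
    by have := corner 0 j 0%N 0%N isT isT; rewrite !addn0 X0.
rewrite addb_telescope /g Y0 Yn cy1 ifF; last by lra.
by rewrite ifF //; lra.
Qed.
End Separation.

(** * Walls of a strip and crossing components *)

Lemma ltn_count (T : eqType) (p q : pred T) (s : seq T) x :
  subpred p q -> x \in s -> q x -> ~~ p x -> (count p s < count q s)%N.
Proof.
move=> pq xs qx npx.
have -> : count q s = (count p s + count (predD q p) s)%N.
  rewrite -count_predUI addnC (@eq_count _ (predI _ _) pred0) ?count_pred0 ?add0n.
    by apply: eq_count => y /=; case: (boolP (p y)) => //= /pq ->.
  by move=> y /=; case: (p y).
rewrite -[X in (X < _)%N]addn0 ltn_add2l -has_count.
by apply/hasP; exists x => //=; rewrite npx.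
Qed.

Section Strip.
Context {R : realType}.
Implicit Types (p q u v w z : R * R) (A B C D E F G H K N P Q Z : set (R * R)).
Implicit Types (a b c d e r x y : R).

Definition vstrip a b : set (R * R) := [set z | a <= z.1 <= b].

Definition crossing_components K a b : set (set (R * R)) :=
  [set C | [/\ components (vstrip a b `\` K) C, exists y, C (a, y) & exists y, C (b, y)]].

Lemma seg_convex_vstrip a b : seg_convex (vstrip a b).
Proof.
move=> u v /= /andP[u1 u2] /andP[v1 v2] z /seg_coord[t [t0 t1 z1 _]].
by rewrite /vstrip /= z1 convex_comb_ge // convex_comb_le.
Qed.

(** A continuum crossing the strip. It may have several points on the left edge;
    [y] is the height of a chosen one, and by [wall_same_side] the choice does
    not matter to the connected sets that avoid the wall. *)
Definition wall a b y P := [/\ compact P, connected P, P `<=` vstrip a b,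
  P (a, y) & exists y', P (b, y')].

Lemma wall_same_side a b y P D z0 z1 : wall a b y P -> compact D -> connected D ->
  D `<=` vstrip a b -> P `&` D = set0 -> D z0 -> D z1 ->
  outer_end a P z0 -> outer_end a P z1 -> (z0.2 <= y) = (z1.2 <= y).
Proof.
move=> [cP kP Pab Pay [y' Pby]] cD kD Dab PD; apply: same_side PD _ Pay _ => //.
  by move=> z [/Pab|/Dab] /andP[].
by exists (b, y') => // z /Dab /andP[].
Qed.

(** Components of the complement of [K] are not compact, but two of their points
    lie in a continuum. *)
Lemma wall_same_side_component K a b y P D d0 d1 : closed K -> wall a b y P -> P `<=` K ->
  components (vstrip a b `\` K) D -> D (a, d0) -> D (a, d1) -> (d0 <= y) = (d1 <= y).
Proof.
move=> cK wP PK hD D0 D1.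
have [G [cG kG GD G0 G1]] := component_continuum (@seg_convex_vstrip a b) cK hD D0 D1.
have GH : G `<=` vstrip a b `\` K by move=> z /GD; exact: components_sub hD _.
apply: (wall_same_side (z0 := (a, d0)) (z1 := (a, d1)) wP cG kG) => //.
- by move=> z /GH[].
- by rewrite -subset0 => z [/PK Kz /GH[]].
- by constructor 1.
- by constructor 1.
Qed.

(** Starting from the right edge, the component of the part of [C] to the right of
    the line of abscissa [a] bumps into that line. *)
Lemma box_component_wall K a0 a b c d C : compact K -> a0 <= a -> a < b ->
  components (K `&` box a0 b c d) C -> (exists2 z, C z & z.1 <= a) ->
  (exists y, C (b, y)) ->
  exists P y, wall a b y P /\ P `<=` C.
Proof.
move=> cK a0a ab hC [z Cz za] [y' Cb].
have CK := components_sub hC.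
have cKb : compact (K `&` box a0 b c d).
  by apply: compact_closedI => //; exact: (closed_compact_hausdorff (@box_compact _ _ _ _ _)).
have cC : compact C.
  apply: (subclosed_compact _ cKb CK); rewrite (componentsP hC Cz).
  by apply: component_closed; exact: closed_compact_hausdorff.
pose E : set (R * R) := [set z | a <= z.1].
have cE : closed E by have [_ h] := closed_coord (@fst_cts R); exact: h.
have Eb : E (b, y') by rewrite /E /= ltW.
pose P := connected_component (C `&` E) (b, y').
have PCE : P `<=` C `&` E by exact: connected_component_sub.
have [w Pw wa] : exists2 w, P w & w.1 = a.
  have [CE|nCE] := pselect (C `<=` E).
    exists z; last by apply/le_anti; rewrite za CE.
    apply: (connected_component_max Cb _ (components_connected hC)) Cz.
    by move=> u Cu; split => //; exact: CE.
  have [w Pw Fw] := boundary_bumping cC (components_connected hC) cE Cb Eb nCE.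
  exists w => //; apply/le_anti/andP; split; last by have [] := PCE _ Pw.
  have [h _] := closed_coord (@fst_cts R); apply: (h a).
  by apply: closureS Fw => u [_ /negP]; rewrite -ltNge => /ltW.
exists P, w.2; split; last by move=> u /PCE[].
split.
- apply: (subclosed_compact _ cC); last by move=> u /PCE[].
  by apply: component_closed; apply: closedI => //; exact: closed_compact_hausdorff.
- exact: component_connected.
- by move=> u /PCE[/CK[_ /boxE[_ ub _ _]] au]; apply/andP.
- by rewrite -wa -surjective_pairing.
- by exists y'; apply: connected_component_refl.
Qed.

(** The component [Z] of the middle wall in the box is confined between the outer
    walls: reaching the top or the bottom would mean crossing one of them. It
    can therefore be split off from the lower wall and from the top and the
    bottom by closed sets, and [crossing_between] provides a crossing in the
    complement of [K] between the lower two walls. The third wall only serves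
    to confine [Z]. *)
Lemma box_component_separation K a0 a b c d C1 C2 C3 P1 P2 P3 y1 y2 y3 :
  compact K -> a0 <= a -> a < b ->
  components (K `&` box a0 b c d) C1 -> components (K `&` box a0 b c d) C2 ->
  components (K `&` box a0 b c d) C3 -> C1 <> C2 -> C2 <> C3 ->
  wall a b y1 P1 -> wall a b y2 P2 -> wall a b y3 P3 ->
  P1 `<=` C1 -> P2 `<=` C2 -> P3 `<=` C3 -> y1 < y2 -> y2 < y3 ->
  exists D, crossing_components K a b D /\ forall x, D (a, x) -> y1 < x < y2.
Proof.
move=> cK a0a ab h1 h2 h3 n12 n23 w1 w2 w3 P1C P2C P3C y12 y23.
have cK' := closed_compact_hausdorff cK.
have PK C y P : components (K `&` box a0 b c d) C -> wall a b y P -> P `<=` C ->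
    P `<=` K `&` box a b c d.
  move=> h [_ _ Pab _ _] PC z Pz; have [Kz /boxE[? ? ? ?]] := components_sub h (PC _ Pz).
  by have /andP[? ?] := Pab _ Pz; split => //; apply/boxE; split.
have PK1 := PK _ _ _ h1 w1 P1C; have PK2 := PK _ _ _ h2 w2 P2C.
have PK3 := PK _ _ _ h3 w3 P3C.
pose KT := K `&` box a b c d.
have cKT : compact KT.
  by apply: compact_closedI => //; exact: (closed_compact_hausdorff (@box_compact _ _ _ _ _)).
have P2a : P2 (a, y2) by case: w2. have P1a : P1 (a, y1) by case: w1.
have P3a : P3 (a, y3) by case: w3.
have P2b : exists y', P2 (b, y') by case: w2.
pose Z := connected_component KT (a, y2).
have ZKT : Z `<=` KT by exact: connected_component_sub.
have Za : Z (a, y2) by apply: connected_component_refl; exact: PK2.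
have cZ : compact Z.
  apply: (subclosed_compact _ cKT) => //; apply: component_closed.
  exact: closed_compact_hausdorff.
have kZ : connected Z by exact: component_connected.
have Zab : Z `<=` vstrip a b.
  by move=> z /ZKT[_ /boxE[? ? _ _]]; apply/andP.
have ZKb : Z `<=` K `&` box a0 b c d.
  move=> z /ZKT[Kz /boxE[? ? ? ?]]; split => //; apply/boxE; split => //; lra.
have Zoff C P y : components (K `&` box a0 b c d) C -> C2 <> C -> P `<=` C -> P `&` Z = set0.
  move=> hC nC PC; rewrite -subset0 => z [Pz Zz]; apply: nC.
  apply: (components_meet h2 hC kZ ZKb); first by exists (a, y2); split => //; exact: P2C.
  by exists z; split => //; exact: PC.
have Z1 : P1 `&` Z = set0 by apply: (Zoff C1) => // /esym.
have Z3 : P3 `&` Z = set0 by exact: (Zoff C3).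
have Zd z : Z z -> z.2 < d.
  move=> Zz; have [_ /boxE[_ _ _ zd]] := ZKT _ Zz; rewrite lt_neqAle zd andbT.
  (* the third wall may itself touch the top, so Z is prolonged above it *)
  apply/eqP => zd'; pose z' := (z.1, z.2 + 1).
  have segz w : seg z z' w -> w.1 = z.1 /\ d <= w.2.
    by move=> /seg_coord[t [t0 t1 -> ->]] /=; rewrite zd'; split; nra.
  have : ((a, y2).2 <= y3) = (z'.2 <= y3).
    apply: (wall_same_side (D := Z `|` seg z z') w3).
    - by apply: compactU => //; exact: seg_compact.
    - apply: connectedU => //; last exact: seg_connected.
      by exists z; split => //; exact: seg_l.
    - move=> w [/Zab//|/segz[E _]]; have := Zab _ Zz; by rewrite /vstrip /= E.
    - rewrite -subset0 => w [P3w [Zw|/segz[E dw]]]; first by rewrite -Z3.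
      have [_ /boxE[_ _ _ wd]] := PK3 _ P3w.
      rewrite -Z3; split; first exact: P3w.
      suff -> : w = z by [].
      rewrite (surjective_pairing w) (surjective_pairing z) E zd'.
      by congr pair; apply/le_anti; rewrite wd.
    - by left.
    - by right; exact: seg_r.
    - by constructor 1.
    - constructor 2 => w /PK3[_ /boxE[_ _ _ wd]]; rewrite /= zd'; lra.
  have [_ /boxE[_ _ _ /= y3d]] := PK3 _ P3a.
  by rewrite /= (ltW y23) zd' => /esym; lra.
have Zc z : Z z -> c < z.2.
  move=> Zz; have [_ /boxE[_ _ cz _]] := ZKT _ Zz; rewrite lt_neqAle cz andbT.
  apply/eqP => zc.
  have : ((a, y2).2 <= y1) = (z.2 <= y1).
    apply: (wall_same_side w1 cZ kZ Zab Z1 Za Zz); first by constructor 1.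
    by constructor 3 => w /PK1[_ /boxE[_ _ wc _]]; rewrite -zc.
  have [_ /boxE[_ _ /= cy1 _]] := PK1 _ P1a.
  by rewrite /= -zc cy1; lra.
have [hle hge] := closed_coord (@snd_cts R).
have cP1 : closed P1 by case: w1 => /closed_compact_hausdorff.
pose F := P1 `|` ([set z | z.2 <= c] `|` [set z | d <= z.2]).
have [||N [cN cKN NK ZN NF]] := @component_clopen_sep _ _ KT (a, y2) F cKT (PK2 _ P2a).
- by apply: closedU => //; apply: closedU.
- rewrite -subset0 => z [Zz [P1z|[|]/=]]; first by rewrite -Z1.
    by rewrite leNgt Zc.
  by rewrite leNgt Zd.
have noF z : N z -> ~ F z by move=> Nz Fz; have : (N `&` F) z by []; rewrite NF.
have [G [cG kG GT [y Gy yy] Gend]] : exists G, [/\ compact G, connected G,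
    G `<=` box a b c d `\` (N `|` (KT `\` N)),
    exists2 y, G (a, y) & y1 < y < y2 &
    (exists y, G (b, y)) \/ (exists2 y, G (a, y) & ~ y1 < y < y2)].
  apply: crossing_between => //.
  - exact: (subclosed_compact cN cKT).
  - by rewrite -subset0 => z [? []].
  - by have [_ /boxE[]] := PK1 _ P1a.
  - by have [_ /boxE[]] := PK2 _ P2a.
  - by split; [exact: PK1|move=> /noF; apply; left].
  - exact: ZN.
  - move=> z /noF nF; rewrite !ltNge; apply/andP; split; apply/negP => h; apply: nF; right;
    by [left|right].
have GK : G `<=` vstrip a b `\` K.
  move=> z /GT[Tz nz]; split; first by case/boxE: Tz => ? ? _ _; apply/andP.
  by move=> Kz; apply: nz; have [Nz|nNz] := pselect (N z); [left|right].
have Gab : G `<=` vstrip a b by move=> z /GK[].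
have sideG x : G (a, x) -> y1 < x < y2.
  move=> Gx.
  have s1 : (y <= y1) = (x <= y1).
    apply: (wall_same_side (z0 := (a, y)) (z1 := (a, x)) w1 cG kG Gab) => //;
      try by constructor 1.
    by rewrite -subset0 => z [/PK1[Kz _] /GK[_]].
  have s2 : (y <= y2) = (x <= y2).
    apply: (wall_same_side (z0 := (a, y)) (z1 := (a, x)) w2 cG kG Gab) => //;
      try by constructor 1.
    by rewrite -subset0 => z [/PK2[Kz _] /GK[_]].
  have xy2 : x != y2.
    by apply/eqP => E; have [_] := GK _ Gx; rewrite E; apply; have [] := PK2 _ P2a.
  move: yy => /andP[h4 h5]; apply/andP; split; first by rewrite ltNge -s1 -ltNge.
  by rewrite lt_neqAle xy2 -s2 ltW.
have {Gend} [y' Gb] : exists y', G (b, y').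
  by case: Gend => // -[x /sideG].
exists (connected_component (vstrip a b `\` K) (a, y)).
have GD : G `<=` connected_component (vstrip a b `\` K) (a, y).
  exact: connected_component_max.
have hD : components (vstrip a b `\` K) (connected_component (vstrip a b `\` K) (a, y)).
  by exists (a, y) => //; exact: GK.
split; first by split; [exact: hD|exists y; exact: GD|exists y'; exact: GD].
move=> x Dx; have Dy := GD _ Gy.
have PK1' : P1 `<=` K by move=> z /PK1[]. have PK2' : P2 `<=` K by move=> z /PK2[].
have s1 := wall_same_side_component cK' w1 PK1' hD Dy Dx.
have s2 := wall_same_side_component cK' w2 PK2' hD Dy Dx.
have xy2 : x != y2.
  by apply/eqP => E; have [_] := components_sub hD Dx; rewrite E; apply; exact: PK2'.
move: yy => /andP[h4 h5]; apply/andP; split; first by rewrite ltNge -s1 -ltNge.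
by rewrite lt_neqAle xy2 -s2 ltW.
Qed.

(** Each component [C] contains a wall. Label [C] by the number of crossing
    components of the complement whose chosen point on the left edge lies
    below this wall. Among three components with the same label,
    [box_component_separation] would insert a crossing component between the
    lower two walls and so make their labels different. *)
Lemma finite_box_components K a0 a b c d : compact K -> a0 <= a -> a < b ->
  finite_set (crossing_components K a b) ->
  finite_set [set C | [/\ components (K `&` box a0 b c d) C,
    exists2 z, C z & z.1 <= a & exists y, C (b, y)]].
Proof.
move=> cK a0a ab /finite_seqP[s Es]; set S := [set C | _].
have /choice[dD hdD] D : exists x, D \in s -> D (a, x).
  have [Ds|nDs] := pselect (D \in s); last by exists 0.
  have : crossing_components K a b D by rewrite Es.
  by case=> _ [x Dx] _; exists x.
have /choice[W hW] C : exists W : set (R * R) * R, S C -> wall a b W.2 W.1 /\ W.1 `<=` C.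
  have [[h1 h2 h3]|nS] := pselect (S C); last by exists (set0, 0).
  by have [P [y h]] := box_component_wall cK a0a ab h1 h2 h3; exists (P, y).
pose n y := count (fun D => dD D < y) s.
suff fib k : finite_set [set C | S C /\ n (W C).2 = k].
  apply: (@sub_finite_set _ _ (\bigcup_(k in `I_(size s).+1) [set C | S C /\ n (W C).2 = k])).
    by move=> C SC; exists (n (W C).2) => //=; rewrite ltnS; exact: count_size.
  by apply: bigcup_finite; [exact: finite_II|move=> k _; exact: fib].
apply: (@no_increasing_triple_finite _ _ _ (fun C => (W C).2)).
  move=> C C' [SC _] [SC' _] E.
  have [[_ _ _ + _] h] := hW _ SC; have [[_ _ _ + _] h'] := hW _ SC'.
  rewrite E => /h' C'y /h Cy; case: (SC) => hC _ _; case: (SC') => hC' _ _.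
  exact: etrans (componentsP hC Cy) (esym (componentsP hC' C'y)).
move=> C1 C2 C3 [S1 n1] [S2 n2] [S3 n3] y12 y23.
have [w1 P1] := hW _ S1; have [w2 P2] := hW _ S2; have [w3 P3] := hW _ S3.
have [D [DF Dy]] : exists D, crossing_components K a b D /\
    forall x, D (a, x) -> (W C1).2 < x < (W C2).2.
  case: (S1) (S2) (S3) => [h1 _ _] [h2 _ _] [h3 _ _].
  apply: (box_component_separation cK a0a ab h1 h2 h3 _ _ w1 w2 w3) => //.
    by move=> E; move: y12; rewrite E ltxx.
  by move=> E; move: y23; rewrite E ltxx.
have Ds : D \in s by move: DF; rewrite Es.
have /andP[d1 d2] := Dy _ (hdD _ Ds).
suff : (n (W C1).2 < n (W C2).2)%N by rewrite n1 n2 ltnn.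
apply: (@ltn_count _ _ _ s D) => //=; last by rewrite -leNgt ltW.
by move=> D' /= h; exact: lt_trans h y12.
Qed.

End Strip.

(** * Locally connected compacta have finitely many crossings *)

Section LocallyConnected.
Context {R : realType}.
Implicit Types (p q u v w z : R * R) (A B C D E F G H K N P Q Z : set (R * R)).
Implicit Types (a b c d e r x y : R).

Lemma strip_components_seg K a b D D' u v : components (vstrip a b `\` K) D ->
  components (vstrip a b `\` K) D' -> D u -> D' v -> seg u v `&` K = set0 -> D = D'.
Proof.
move=> hD hD' Du Dv uvK.
apply: (components_meet hD hD' (@seg_connected _ _ u v)).
- move=> w uvw; split; last by move=> Kw; have : (seg u v `&` K) w by []; rewrite uvK.
  have [Hu _] := components_sub hD Du; have [Hv _] := components_sub hD' Dv.
  exact: (seg_convex_vstrip Hu Hv).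
- by exists u; split => //; exact: seg_l.
- by exists v; split => //; exact: seg_r.
Qed.

(** The continuum [E] follows [D] from the left edge to [u], and then the segment
    towards [v] until it first hits [K]. This happens before it reaches any
    component of the complement other than [D]. *)
Lemma component_to_boundary K a b z e D D' x u v : closed K ->
  ball z e `<=` vstrip a b -> components (vstrip a b `\` K) D ->
  components (vstrip a b `\` K) D' -> D <> D' ->
  D (a, x) -> D u -> D' v -> ball z e u -> ball z e v ->
  exists E, [/\ compact E, connected E, E `<=` vstrip a b, E (a, x) &
    (E `&` (K `&` ball z e) !=set0) /\
    forall D'', components (vstrip a b `\` K) D'' -> D'' <> D -> E `&` D'' = set0].
Proof.
move=> cK zab hD hD' DD' Dx Du D'v zu zv.
have [G [cG kG GD Gx Gu]] := component_continuum (@seg_convex_vstrip _ a b) cK hD Dx Du.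
have hit : seg u v `&` K !=set0.
  by apply/set0P/negP => /eqP /(strip_components_seg hD hD' Du D'v).
have [k [Kk uvk ukK]] := first_hit cK hit.
have zk : ball z e k by exact: (seg_convex_ball zu zv).
exists (G `|` seg u k); split.
- by apply: compactU => //; exact: seg_compact.
- apply: connectedU => //; last exact: seg_connected.
  by exists u; split => //; exact: seg_l.
- move=> w [/GD /(components_sub hD)[]//|ukw].
  by apply: zab; exact: (seg_convex_ball zu zk).
- by left.
- split; first by exists k; split; [right; exact: seg_r|].
  move=> D'' hD'' nD; rewrite -subset0 => w [[/GD Dw|ukw] D''w].
    by apply: nD; rewrite (componentsP hD'' D''w) -(componentsP hD Dw).
  have [_ nKw] := components_sub hD'' D''w.
  by apply: nD; rewrite -(strip_components_seg hD hD'' Du D''w (ukK _ ukw nKw)).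
Qed.

(** Prolong the lower and the upper of three crossing components up to points of
    [K] in a ball and join these points by the continuum [N] of [K]: the
    result passes from below to above the middle component without meeting
    it. *)
Lemma three_crossings K a b z e N D1 D2 D3 d1 d2 d3 u1 u3 : closed K ->
  compact N -> connected N -> N `<=` K -> ball z e `<=` vstrip a b ->
  N `<=` vstrip a b -> K `&` ball z e `<=` N ->
  crossing_components K a b D1 -> crossing_components K a b D2 ->
  crossing_components K a b D3 -> D1 (a, d1) -> D2 (a, d2) -> D3 (a, d3) ->
  D1 <> D2 -> D2 <> D3 -> D1 <> D3 ->
  d1 < d2 -> d2 < d3 -> D1 u1 -> D3 u3 -> ball z e u1 -> ball z e u3 -> False.
Proof.
move=> cK cN kN NK zab Nab KN S1 S2 S3 D1a D2a D3a n12 n23 n13 d12 d23 Du1 Du3 b1 b3.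
have [h1 _ _] := S1; have [h3 _ _] := S3; have [h2 _ [y D2b]] := S2.
have [G2 [cG2 kG2 GD2 G2a G2b]] :=
  component_continuum (@seg_convex_vstrip _ a b) cK h2 D2a D2b.
have DH := components_sub h2.
have w2 : wall a b d2 G2.
  by split => //; [move=> w /GD2/DH[]|exists y].
have [E1 [cE1 kE1 E1ab E1a [[k1 [E1k [K1 z1]]] /(_ _ h2 (nesym n12)) E12]]] :=
  component_to_boundary cK zab h1 h3 n13 D1a Du1 Du3 b1 b3.
have [E3 [cE3 kE3 E3ab E3a [[k3 [E3k [K3 z3]]] /(_ _ h2 n23) E32]]] :=
  component_to_boundary cK zab h3 h1 (nesym n13) D3a Du3 Du1 b3 b1.
have : ((a, d1).2 <= d2) = ((a, d3).2 <= d2).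
  apply: (wall_same_side (D := E1 `|` (N `|` E3)) w2).
  - by apply: compactU => //; exact: compactU.
  - apply: connectedU => //; first by exists k1; split => //; left; exact: KN.
    by apply: connectedU => //; exists k3; split => //; exact: KN.
  - by rewrite !subUset.
  - rewrite -subset0 => w [/GD2 Dw [Ew|[/NK Kw|Ew]]].
    + by rewrite -E12.
    + by have [] := DH _ Dw.
    + by rewrite -E32.
  - by left.
  - by right; right.
  - by constructor 1.
  - by constructor 1.
by rewrite /= (ltW d12) => /esym; rewrite leNgt d23.
Qed.

(** Every crossing component meets a bounded piece of the middle line of the
    strip: beyond the height of [K] it can slide along that line. So
    finiteness only has to be checked near a point [z] of this piece. Off [K]
    a small ball meets at most one component; at a point of [K], local
    connectedness yields the continuum needed by [three_crossings], and at
    most two components come close to [z]. *)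
Theorem locally_connected_finite_crossings K a b : compact K -> locally_connected K ->
  a < b -> finite_set (crossing_components K a b).
Proof.
move=> cK lcK ab; have cK' := closed_compact_hausdorff cK.
have [M M0 KM] : exists2 M, 0 <= M & forall z, K z -> - M < z.2 < M.
  have [M [_ hM]] := compact_bounded cK; exists (Num.max M 0 + 2) => [|z Kz].
    by rewrite addr_ge0 // le_max lexx orbT.
  have MM : M < Num.max M 0 + 1 by rewrite -[ltLHS]addr0 ler_ltD // le_max lexx.
  have /= := hM _ MM _ Kz; rewrite pair_norm_le => /andP[_]; rewrite ler_norml => /andP[? ?].
  by apply/andP; split; lra.
pose m := (a + b) / 2.
have mab : a < m < b by rewrite /m; apply/andP; split; lra.
have /choice[dD hdD] D : exists x, crossing_components K a b D -> D (a, x).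
  have [[_ [x Dx] _]|nD] := pselect (crossing_components K a b D); last by exists 0.
  by exists x.
have cmp D : crossing_components K a b D -> components (vstrip a b `\` K) D by case.
apply: (locally_finite_family (@box_compact _ m m (- M) M)); last first.
  move=> D [hD [y Da] [y' Db]].
  have [z Dz zm] : exists2 z, D z & z.1 = m.
    have /connected_intervalP iD : connected [set fst z | z in D].
      apply: connected_continuous_connected; first exact: components_connected hD.
      by apply: continuous_subspaceT; exact: fst_cts.
    have : [set fst z | z in D] m.
      apply: (iD a b) => //; [by exists (a, y)|by exists (b, y')|].
      by case/andP: mab => *; apply/andP; split; exact: ltW.
    by move=> [z Dz <-]; exists z.
  have slide s : seg z (m, s) `&` K = set0 -> D (m, s).
    move=> zsK; have Hs : (vstrip a b `\` K) (m, s).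
      split; first by case/andP: mab => *; apply/andP; split; exact: ltW.
      by move=> Ks; have : (seg z (m, s) `&` K) (m, s);
        [split => //; exact: seg_r|rewrite zsK].
    have Ds := connected_component_refl Hs.
    have hD' : components (vstrip a b `\` K) (connected_component (vstrip a b `\` K) (m, s)).
      by exists (m, s).
    by rewrite (strip_components_seg hD hD' Dz Ds zsK).
  have [zM|zM] := leP z.2 M; last first.
    exists (m, M); split; last first.
      apply/boxE; split => //=; lra.
    apply: slide; rewrite -subset0 => w [/seg_coord[t [t0 t1 _ w2]] /KM/andP[_]].
    by rewrite w2 ltNge convex_comb_ge // ltW.
  have [Mz|Mz] := leP (- M) z.2; last first.
    exists (m, - M); split; last first.
      apply/boxE; split => //=; lra.
    apply: slide; rewrite -subset0 => w [/seg_coord[t [t0 t1 _ w2]] /KM/andP[+ _]].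
    by rewrite w2 ltNge convex_comb_le // ltW.
  by exists z; split => //; apply/boxE; split => //; rewrite zm.
move=> z /boxE[z1 z2 _ _].
have {z1 z2} zm : z.1 = m by apply/le_anti; rewrite z1 z2.
have near_ab e : e <= (b - a) / 4 -> ball z e `<=` vstrip a b.
  move=> eb w; rewrite -ball_normE /= pair_norm_lt /= => /andP[+ _].
  rewrite zm /m ltr_norml => /andP[? ?]; rewrite /vstrip /=; apply/andP; split; lra.
have e40 : 0 < (b - a) / 4 by rewrite divr_gt0 ?subr_gt0.
have [Kz|nKz] := pselect (K z); last first.
  have /closed_normP/(_ _ nKz)[e e0 he] := cK'.
  exists e => //; apply: (@no_increasing_triple_finite R _ _ (fun=> 0)); last first.
    by move=> ? ? ? _ _ _; rewrite ltxx.
  move=> D D' [SD [u [Du zu]]] [SD' [v [Dv zv]]] _.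
  apply: (strip_components_seg (cmp _ SD) (cmp _ SD') Du Dv).
  rewrite -subset0 => w [uvw Kw]; have := seg_convex_ball zu zv uvw.
  by rewrite -ball_normE /= ltNge he.
have [|O [oO Oz OV kO]] := lcK z (ball z ((b - a) / 4)) Kz.
  by apply: nbhsx_ballx.
have /nbhs_ballP[e /= e0 eO] : nbhs z O by exact: open_nbhs_nbhs.
pose r := Num.min e ((b - a) / 4).
have r0 : 0 < r by rewrite lt_min e0.
have rab : ball z r `<=` vstrip a b by apply: near_ab; rewrite ge_min lexx orbT.
have cH : closed (vstrip a b).
  have [h1 h2] := closed_coord (@fst_cts R).
  have -> : vstrip a b = [set z | a <= z.1] `&` [set z | z.1 <= b].
    by rewrite eqEsubset; split=> w /=; [move/andP|move=> [? ?]; apply/andP].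
  exact: closedI.
pose N := closure (K `&` O).
have NK : N `<=` K by rewrite [X in _ `<=` X](closure_id _).1//; apply: closureS => w [].
have Nab : N `<=` vstrip a b.
  rewrite [X in _ `<=` X](closure_id _).1//; apply: closureS.
  by apply: subset_trans OV _; exact: near_ab.
have KN : K `&` ball z r `<=` N.
  move=> w [Kw zw]; apply: subset_closure; split => //; apply: eO.
  by apply: le_ball zw; rewrite ge_min lexx.
have cN : compact N by apply: (subclosed_compact _ cK NK); exact: closed_closure.
have kN : connected N by exact: connected_closure.
exists r => //; apply: (@no_increasing_triple_finite R _ _ dD).
  move=> D D' [SD _] [SD' _] E.
  have Dx := hdD _ SD; have := hdD _ SD'; rewrite -E => D'x.
  exact: etrans (componentsP (cmp _ SD) Dx) (esym (componentsP (cmp _ SD') D'x)).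
move=> D1 D2 D3 [S1 [u1 [Du1 b1]]] [S2 _] [S3 [u3 [Du3 b3]]] d12 d23.
have nd D D' : dD D < dD D' -> D <> D' by move=> + E; rewrite E ltxx.
apply: (three_crossings cK' cN kN NK rab Nab KN S1 S2 S3 (hdD _ S1) (hdD _ S2) (hdD _ S3)
  _ _ _ d12 d23 Du1 Du3 b1 b3); apply: nd => //.
exact: lt_trans d23.
Qed.

End LocallyConnected.

(** * Strips of arbitrary direction *)

Section Homeomorphism.
Context {T U : topologicalType} (f : T -> U) (g : U -> T).
Hypotheses (fc : continuous f) (gc : continuous g) (fK : cancel f g) (gK : cancel g f).

Lemma image_connected (A : set T) : connected A -> connected (f @` A).
Proof.
move=> kA; apply: connected_continuous_connected => //; exact: continuous_subspaceT.
Qed.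

Lemma image_locally_connected (A : set T) : locally_connected A -> locally_connected (f @` A).
Proof.
move=> lA _ V [x Ax <-] fV; have [O [oO Ox OV kO]] := lA x _ Ax (fc fV).
have E : f @` A `&` g @^-1` O = f @` (A `&` O).
  rewrite eqEsubset; split=> [_ [[y Ay <-]] /=|_ [y [Ay Oy] <-]].
    by rewrite fK => Oy; exists y.
  by split; [exists y|rewrite /= fK].
exists (g @^-1` O); split.
- by apply: open_comp => // y _; exact: gc.
- by rewrite /= fK.
- by rewrite E => _ [y /OV Vy <-].
- by rewrite E; exact: image_connected.
Qed.

Lemma image_component_sub (A : set T) x :
  f @` connected_component A x `<=` connected_component (f @` A) (f x).
Proof.
move=> _ [y [C [Cx CA kC] Cy] <-]; exists (f @` C); last by exists y.
by split; [exists x|exact: image_subset|exact: image_connected].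
Qed.

End Homeomorphism.

Lemma image_components (T U : topologicalType) (f : T -> U) (g : U -> T) (A : set T) C :
  continuous f -> continuous g -> cancel f g -> cancel g f ->
  components A C -> components (f @` A) (f @` C).
Proof.
move=> fc gc fK gK [x Ax <-]; exists (f x); first by exists x.
rewrite eqEsubset; split; last exact: image_component_sub.
move=> y hy; exists (g y) => //.
have := @image_component_sub _ _ g gc (f @` A) (f x) (g y).
have -> : g @` (f @` A) = A.
  rewrite eqEsubset; split=> [_ [_ [z Az <-] <-]|z Az]; first by rewrite fK.
  by exists (f z); [exists z|rewrite fK].
by rewrite fK; apply; exists y.
Qed.

Section Turn.
Context {R : realType}.
Implicit Types (p q u v w z : R * R) (A B C D E F G H K N P Q Z : set (R * R)).
Implicit Types (a b c d e r s t : R).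

(** Multiplication by the complex number [v.2 + i v.1], a similarity that makes
    the lines of direction [v] vertical. *)
Definition turn v z : R * R := (v.2 * z.1 - v.1 * z.2, v.1 * z.1 + v.2 * z.2).

(** Division by the same complex number. *)
Definition unturn v z : R * R :=
  ((v.1 ^+ 2 + v.2 ^+ 2)^-1 * (v.2 * z.1 + v.1 * z.2),
   (v.1 ^+ 2 + v.2 ^+ 2)^-1 * (v.2 * z.2 - v.1 * z.1)).

Lemma linear_cts (x y : R) : continuous (fun z => x * z.1 + y * z.2 : R).
Proof.
move=> z; apply: cvgD.
  by apply: (@cvgM _ _ (nbhs z) _ (fun=> x) fst x z.1); [exact: cvg_cst|exact: cvg_fst].
by apply: (@cvgM _ _ (nbhs z) _ (fun=> y) snd y z.2); [exact: cvg_cst|exact: cvg_snd].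
Qed.

Lemma pair_cts (f g : R * R -> R) : continuous f -> continuous g ->
  continuous (fun z => (f z, g z)).
Proof. by move=> fc gc z; exact: (cvg_pair (fc z) (gc z)). Qed.

(** The linear form whose level sets are the lines of direction [v]. *)
Definition level v z := (turn v z).1.

Lemma level_cts v : continuous (level v).
Proof.
have -> : level v = (fun z => v.2 * z.1 + (- v.1) * z.2).
  by apply/funext => z; rewrite mulNr.
exact: linear_cts.
Qed.

Lemma turn_cts v : continuous (turn v).
Proof. by apply: pair_cts; [exact: level_cts|exact: linear_cts]. Qed.

Lemma unturn_cts v : continuous (unturn v).
Proof.
pose n := (v.1 ^+ 2 + v.2 ^+ 2)^-1.
have -> : unturn v = fun z => (n * v.2 * z.1 + n * v.1 * z.2, (- (n * v.1)) * z.1 + n * v.2 * z.2).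
  by apply/funext => z; rewrite /unturn -/n; congr pair; ring.
by apply: pair_cts; exact: linear_cts.
Qed.

Lemma sqr_norm_neq0 v : v != 0 -> v.1 ^+ 2 + v.2 ^+ 2 != 0.
Proof.
apply: contra_neq => /eqP; rewrite paddr_eq0 ?sqr_ge0// !sqrf_eq0 => /andP[/eqP v1 /eqP v2].
by rewrite (surjective_pairing v) v1 v2.
Qed.

Lemma turnK v : v != 0 -> cancel (turn v) (unturn v).
Proof.
move=> /sqr_norm_neq0 v0 z; rewrite (surjective_pairing z) /unturn /turn /=.
by congr pair; field.
Qed.

Lemma unturnK v : v != 0 -> cancel (unturn v) (turn v).
Proof.
move=> /sqr_norm_neq0 v0 z; rewrite (surjective_pairing z) /unturn /turn /=.
by congr pair; field.
Qed.

Lemma lineE z0 v : v != 0 -> line z0 v = [set z | level v z = level v z0].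
Proof.
move=> v0; rewrite eqEsubset; split=> [_ [t _ <-]|z /= zz].
  by rewrite /level /= /GRing.scale /=; ring.
have n0 := sqr_norm_neq0 v0.
pose t := ((turn v z).2 - (turn v z0).2) / (v.1 ^+ 2 + v.2 ^+ 2).
exists t => //; apply: (can_inj (turnK v0)).
rewrite [RHS]surjective_pairing [LHS]surjective_pairing; congr pair.
  by rewrite [RHS]zz /level /turn /= /GRing.scale /=; ring.
by rewrite /t /turn /= /GRing.scale /=; field.
Qed.

Definition band v s t : set (R * R) := [set z | s < level v z < t].

Lemma level_seg v x y z : seg x y z ->
  exists t, [/\ 0 <= t, t <= 1 & level v z = (1 - t) * level v x + t * level v y].
Proof.
move=> /seg_coord[t [t0 t1 z1 z2]]; exists t; split => //.
by rewrite /level /turn /= z1 z2; ring.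
Qed.

Lemma band_connected v s t : connected (band v s t).
Proof.
apply: seg_convex_connected => x y /andP[x1 x2] /andP[y1 y2] z /level_seg-/(_ v)[r [r0 r1 E]].
rewrite /band /= E.
have sx : s < Num.min (level v x) (level v y) by rewrite lt_min x1.
have xt : Num.max (level v x) (level v y) < t by rewrite gt_max x2.
apply/andP; split; [apply: lt_le_trans sx _|apply: le_lt_trans xt].
  by apply: convex_comb_ge => //; rewrite ge_min lexx ?orbT.
by apply: convex_comb_le => //; rewrite le_max lexx ?orbT.
Qed.

Lemma level_unturn v (x y : R) : v != 0 -> level v (unturn v (x, y)) = x.
Proof. by move=> v0; rewrite /level unturnK. Qed.

Lemma closed_level v (x : R) : closed [set z | level v z <= x] /\ closed [set z | x <= level v z].
Proof. by have [h1 h2] := closed_coord (@level_cts v). Qed.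

Lemma closed_band v s t : closed [set z | s <= level v z <= t].
Proof.
have [h1 _] := closed_level v t; have [_ h2] := closed_level v s.
have -> : [set z | s <= level v z <= t] = [set z | s <= level v z] `&` [set z | level v z <= t].
  by rewrite eqEsubset; split=> w /=; [move/andP|move=> [? ?]; apply/andP].
exact: closedI.
Qed.

Lemma connected_level v C x y s : connected C -> C x -> C y ->
  level v x <= s -> s <= level v y -> exists2 z, C z & level v z = s.
Proof.
move=> kC Cx Cy xs sy.
have /connected_intervalP iC : connected [set level v z | z in C].
  apply: connected_continuous_connected => //.
  by apply: continuous_subspaceT; exact: level_cts.
have : [set level v z | z in C] s.
  by apply: (iC (level v x) (level v y)); [exists x|exists y|rewrite xs].
by move=> [z Cz <-]; exists z.
Qed.

Definition levels v s t : set (R * R) := [set z | level v z = s] `|` [set z | level v z = t].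

(** A connected set avoiding the two lines cannot leave the band, because its
    levels form an interval. *)
Lemma band_component v s t x : s < t -> band v s t x ->
  connected_component (~` levels v s t) x = band v s t.
Proof.
move=> st bx; rewrite eqEsubset; split; last first.
  apply: connected_component_max => //; last exact: band_connected.
  by move=> z /andP[h1 h2] [] /= E; move: h1 h2; rewrite E ltxx.
move=> z Cz; have kC := @component_connected _ (~` levels v s t) x.
have Cx : connected_component (~` levels v s t) x x.
  apply: connected_component_refl => -[] /= E; move: bx; rewrite /band /= E ltxx ?andbF //.
have off w : connected_component (~` levels v s t) x w -> ~ levels v s t w.
  exact: connected_component_sub.
case/andP: bx => h1 h2; apply/andP; split; rewrite ltNge; apply/negP => h.
  have [w /off nw E] := connected_level kC Cz Cx h (ltW h1).
  by apply: nw; left.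
have [w /off nw E] := connected_level kC Cx Cz (ltW h2) h.
by apply: nw; right.
Qed.

Lemma closure_band v s t : v != 0 -> s < t ->
  closure (band v s t) = [set z | s <= level v z <= t].
Proof.
move=> v0 st; rewrite eqEsubset; split.
  rewrite [X in _ `<=` X](closure_id _).1; last exact: closed_band.
  by apply: closureS => z /andP[h1 h2]; apply/andP; split; exact: ltW.
move=> z /andP[h1 h2]; apply/closure_normP => e e0.
pose x := unturn v ((s + t) / 2, 0).
have xE : level v x = (s + t) / 2 by exact: level_unturn.
pose r := Num.min 1 (e / (`|x - z| + 1)).
have n1 : 0 < `|x - z| + 1 by rewrite ltr_wpDl.
have r0 : 0 < r by rewrite lt_min ltr01 divr_gt0.
have r1 : r <= 1 by rewrite ge_min lexx.
have re : r * (`|x - z| + 1) <= e.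
  by rewrite -ler_pdivlMr // ge_min lexx orbT.
have sy : seg z x (z + r *: (x - z)).
  by exists r => //; rewrite /= in_itv /= r1 ltW.
exists (z + r *: (x - z)).
  have E : level v (z + r *: (x - z)) = (1 - r) * level v z + r * level v x.
    by rewrite /level /turn /= /GRing.scale /=; ring.
  by rewrite /band /= E xE; apply/andP; split; nra.
rewrite opprD addrA subrr add0r normrN normrZ gtr0_norm //.
by apply: lt_le_trans re; rewrite ltr_pM2l // ltrDl.
Qed.

Lemma strip_band v s t : v != 0 -> s < t ->
  strip [set z | level v z = s] [set z | level v z = t] (band v s t).
Proof.
move=> v0 st; split.
  pose x := unturn v ((s + t) / 2, 0).
  have bx : band v s t x.
    by rewrite /band /= level_unturn //; apply/andP; split; lra.
  exists x; last exact: band_component.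
  by move=> [] /= E; move: bx; rewrite /band /= E ltxx ?andbF.
rewrite /frontier closure_band //.
have cB : closed (~` band v s t).
  have [h1 _] := closed_level v s; have [_ h2] := closed_level v t.
  have -> : ~` band v s t = [set z | level v z <= s] `|` [set z | t <= level v z].
    rewrite eqEsubset; split=> z; rewrite /band /=.
      move/negP; rewrite negb_and -!leNgt => /orP //.
    by move=> [h|h] /andP[h3 h4]; lra.
  exact: closedU.
rewrite -((closure_id _).1 cB) eqEsubset; split=> z.
  move=> [/andP[h1 h2] /negP]; rewrite negb_and -!leNgt => /orP[h|h]; [left|right];
  by apply/le_anti; rewrite ?h1 ?h2 h.
by case=> /= E; rewrite /band /= E ?lexx ?ltxx ?andbF ltW.
Qed.

(** A component lying in one of the outer half-planes has a frontier that misses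
    one of the two lines, so a strip in the sense of components and frontiers
    is the band between the lines. *)
Lemma closure_strip v s t U : v != 0 -> s < t ->
  strip [set z | level v z = s] [set z | level v z = t] U ->
  closure U = [set z | s <= level v z <= t].
Proof.
move=> v0 st [hU fU].
have kU := components_connected hU.
have off z : U z -> ~ levels v s t z by exact: components_sub hU _.
have lv z : levels v s t z -> closure U z by rewrite /levels -fU => -[].
have [x Ux] : U !=set0.
  have [|z] := lv (unturn v (s, 0)) _ setT filterT; last by move=> [Uz _]; exists z.
  by left; rewrite /= level_unturn.
suff bx : band v s t x.
  have -> : U = band v s t; last exact: closure_band.
  by rewrite (componentsP hU Ux) band_component.
apply/andP; split; rewrite ltNge; apply/negP => h.
  have : closure U (unturn v (t, 0)) by apply: lv; right; rewrite /= level_unturn.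
  have [cl _] := closed_level v s.
  have Us : U `<=` [set z | level v z <= s].
    move=> z Uz /=; rewrite leNgt; apply/negP => /ltW sz.
    by have [w /off nw E] := connected_level kU Ux Uz h sz; apply: nw; left.
  move=> /(closureS Us) /cl; rewrite /= level_unturn // => ts; lra.
have : closure U (unturn v (s, 0)) by apply: lv; left; rewrite /= level_unturn.
have [_ cl] := closed_level v t.
have Us : U `<=` [set z | t <= level v z].
  move=> z Uz /=; rewrite leNgt; apply/negP => /ltW sz.
  by have [w /off nw E] := connected_level kU Uz Ux sz h; apply: nw; right.
move=> /(closureS Us) /cl; rewrite /= level_unturn // => ts; lra.
Qed.

Lemma turn_band v K s t : v != 0 ->
  turn v @` ([set z | s <= level v z <= t] `\` K) = vstrip s t `\` (turn v @` K).
Proof.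
move=> v0; rewrite eqEsubset; split=> [_ [z [h nK] <-]|z [h nK]].
  by split => // -[u Ku /(can_inj (turnK v0)) E]; apply: nK; rewrite -E.
exists (unturn v z); last exact: unturnK.
split; first by rewrite /= /level unturnK.
by move=> Kz; apply: nK; exists (unturn v z) => //; exact: unturnK.
Qed.

Lemma unturn_band v K s t : v != 0 ->
  unturn v @` (vstrip s t `\` (turn v @` K)) = [set z | s <= level v z <= t] `\` K.
Proof.
move=> v0; rewrite -turn_band // image_comp (_ : unturn v \o turn v = id) ?image_id //.
by apply/funext => z; exact: turnK.
Qed.

Lemma schoenflies_finite_crossings K v a b : schoenflies K -> v != 0 -> a < b ->
  finite_set (crossing_components (turn v @` K) a b).
Proof.
move=> sK v0 ab.
pose L s := line (unturn v (s, 0)) v.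
have LE s : L s = [set z | level v z = s] by rewrite /L lineE // level_unturn.
have : finite_set [set C | [/\ components (closure (band v a b) `\` K) C,
    C `&` L a !=set0 & C `&` L b !=set0]].
  apply: sK.
  - by exists v, (unturn v (a, 0)), (unturn v (b, 0)).
  - move=> E; have : L a (unturn v (a, 0)) by rewrite LE /= level_unturn.
    by rewrite E LE /= level_unturn // => ba; move: ab; rewrite ba ltxx.
  - by rewrite !LE; exact: strip_band.
rewrite closure_band // !LE => fin.
have {}fin := finite_image (fun C => turn v @` C) fin.
apply: (sub_finite_set _ fin) => D [hD [y Da] [y' Db]]; exists (unturn v @` D); last first.
  rewrite image_comp (_ : turn v \o unturn v = id) ?image_id //.
  by apply/funext => z; exact: unturnK.
split.
- rewrite -unturn_band //; apply: image_components hD; 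
    [exact: unturn_cts|exact: turn_cts|exact: unturnK|exact: turnK].
- exists (unturn v (a, y)); split; first by exists (a, y).
  by rewrite /= level_unturn.
- exists (unturn v (b, y')); split; first by exists (b, y').
  by rewrite /= level_unturn.
Qed.

Lemma finite_crossings_strip K v s t U : v != 0 -> s < t ->
  (forall a b, a < b -> finite_set (crossing_components (turn v @` K) a b)) ->
  strip [set z | level v z = s] [set z | level v z = t] U ->
  finite_set [set C | [/\ components (closure U `\` K) C,
    C `&` [set z | level v z = s] !=set0 & C `&` [set z | level v z = t] !=set0]].
Proof.
move=> v0 st hK hU; rewrite (closure_strip v0 st hU).
have fin := finite_image (fun C => unturn v @` C) (hK _ _ st).
apply: (sub_finite_set _ fin) => C [hC [x [Cx xs]] [y [Cy yt]]]; exists (turn v @` C); last first.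
  rewrite image_comp (_ : unturn v \o turn v = id) ?image_id //.
  by apply/funext => z; exact: turnK.
split.
- rewrite -turn_band //; apply: image_components hC; 
    [exact: turn_cts|exact: unturn_cts|exact: turnK|exact: unturnK].
- by exists (turn v x).2; exists x => //; rewrite -xs [LHS]surjective_pairing.
- by exists (turn v y).2; exists y => //; rewrite -yt [LHS]surjective_pairing.
Qed.

Lemma finite_crossings_schoenflies K :
  (forall v a b, v != 0 -> a < b -> finite_set (crossing_components (turn v @` K) a b)) ->
  schoenflies K.
Proof.
move=> hK L1 L2 U [v [p [q [v0 -> ->]]]]; rewrite !lineE // => pq hU.
have [st|ts|E] := ltgtP (level v p) (level v q).
- by apply: finite_crossings_strip => // a b; exact: hK.
- have hU' : strip [set z | level v z = level v q] [set z | level v z = level v p] U.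
    by move: hU; rewrite /strip setUC.
  have := finite_crossings_strip v0 ts (fun a b => hK v a b v0) hU'.
  by apply: sub_finite_set => C [].
- by case: pq; rewrite E.
Qed.

End Turn.

(** * Finitely many crossings imply local connectedness *)

Section Assembly.
Context {R : realType}.
Implicit Types (p q u v w z : R * R) (A B C D E F G H K N P Q Z : set (R * R)).
Implicit Types (a b c d e r s t : R).

Definition square z r : set (R * R) := box (z.1 - r) (z.1 + r) (z.2 - r) (z.2 + r).

Lemma squareP z r u : square z r u <-> `|z - u| <= r.
Proof.
rewrite pair_norm_le /= !ler_norml; split=> [/boxE[? ? ? ?]|/andP[/andP[? ?] /andP[? ?]]].
  by apply/andP; split; apply/andP; split; lra.
by apply/boxE; split; lra.
Qed.

(** The four directions whose turns are the rotations by multiples of a right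
    angle; these preserve squares and bring each side of a square to the
    right. *)
Definition axis v := v \in [:: (0, 1); (0, -1); (1, 0); (-1, 0)].

Lemma axis_neq0 v : axis v -> v != 0.
Proof.
by rewrite /axis !inE => /or4P[] /eqP->; rewrite xpair_eqE ?oppr_eq0 oner_eq0 ?andbF.
Qed.

Lemma turn_square v z r u : axis v -> square (turn v z) r (turn v u) <-> square z r u.
Proof.
rewrite /axis !inE => /or4P[] /eqP->; split=> /boxE[/=] *; apply/boxE; rewrite /turn /=; split; lra.
Qed.

Lemma turn_squareI v K z r : axis v ->
  turn v @` (K `&` square z r) = turn v @` K `&` square (turn v z) r.
Proof.
move=> av; rewrite eqEsubset; split=> [_ [u [Ku zu] <-]|_ [[u Ku <-] /(turn_square _ _ _ av) zu]].
  by split; [exists u|apply/turn_square].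
by exists u.
Qed.

Lemma finite_side_components K z r v : compact K -> 0 < r -> axis v ->
  (forall a b, a < b -> finite_set (crossing_components (turn v @` K) a b)) ->
  finite_set [set C | [/\ components (K `&` square z r) C,
    exists2 u, C u & level v u <= level v z + r / 2 &
    exists2 u, C u & level v u = level v z + r]].
Proof.
move=> cK r0 av hK; have v0 := axis_neq0 av.
have cvK : compact (turn v @` K).
  by apply: continuous_compact => //; apply: continuous_subspaceT; exact: turn_cts.
have r2 : level v z + r / 2 < level v z + r by lra.
have a0 : level v z - r <= level v z + r / 2 by lra.
have fin := @finite_box_components _ _ _ _ _ ((turn v z).2 - r) ((turn v z).2 + r)
  cvK a0 r2 (hK _ _ r2).
have {}fin := finite_image (fun C => unturn v @` C) fin.
apply: (sub_finite_set _ fin) => C [hC [u Cu ur] [w Cw wr]].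
exists (turn v @` C); last first.
  rewrite image_comp (_ : unturn v \o turn v = id) ?image_id //.
  by apply/funext => x; exact: turnK.
split.
- have := image_components (@turn_cts _ v) (@unturn_cts _ v) (turnK v0) (unturnK v0) hC.
  by rewrite turn_squareI.
- by exists (turn v u) => //; exists u.
- by exists (turn v w).2; exists w => //; rewrite -wr [LHS]surjective_pairing.
Qed.

Lemma norm_axis z u r : 0 < r -> `|z - u| = r -> exists2 v, axis v & level v u = level v z + r.
Proof.
move=> r0 E; have : `|z - u| <= r by rewrite E.
have : r <= `|z - u| by rewrite E.
rewrite pair_norm_le pair_norm_ge /= !ler_norml !ler_normr.
move=> /orP[/orP[]|/orP[]] h /andP[/andP[h1 h2] /andP[h3 h4]].
- by exists (0, -1); rewrite /axis ?inE ?eqxx ?orbT // /level /turn /=; lra.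
- by exists (0, 1); rewrite /axis ?inE ?eqxx ?orbT // /level /turn /=; lra.
- by exists (1, 0); rewrite /axis ?inE ?eqxx ?orbT // /level /turn /=; lra.
- by exists (-1, 0); rewrite /axis ?inE ?eqxx ?orbT // /level /turn /=; lra.
Qed.

Lemma level_half v z u r : axis v -> `|z - u| <= r -> level v u <= level v z + r.
Proof.
rewrite /axis !inE => /or4P[] /eqP->; rewrite pair_norm_le /= !ler_norml /level /turn /=;
  move=> /andP[/andP[h1 h2] /andP[h3 h4]]; lra.
Qed.

(** Unless [K] is contained in the square, each of these components bumps into one
    of its sides and so crosses the strip of half the radius along that side;
    the four sides are treated by turning. *)
Lemma finite_square_components K z r : compact K -> connected K -> K z -> 0 < r ->
  (forall v a b, v != 0 -> a < b -> finite_set (crossing_components (turn v @` K) a b)) ->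
  finite_set [set C | components (K `&` square z r) C /\ exists2 u, C u & `|z - u| <= r / 2].
Proof.
move=> cK kK Kz r0 hK.
have [KQ|nKQ] := pselect (K `<=` square z r).
  rewrite (setIidl KQ); apply: (sub_finite_set _ (finite_set1 K)) => C [hC [u Cu _]] /=.
  rewrite eqEsubset; split; first exact: components_sub.
  rewrite (componentsP hC Cu); apply: connected_component_max => //.
  exact: components_sub hC _ Cu.
have cQ : closed (square z r) by exact: (closed_compact_hausdorff (@box_compact _ _ _ _ _)).
have fin v : v \in [set` [:: (0, 1); (0, -1); (1, 0); (-1, 0) : R * R]] ->
  finite_set [set C | [/\ components (K `&` square z r) C,
    exists2 u, C u & level v u <= level v z + r / 2 &
    exists2 u, C u & level v u = level v z + r]].
  move=> /set_mem av; apply: finite_side_components => // a b.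
  by apply: hK; exact: axis_neq0.
have {}fin := bigcup_finite (finite_seq [:: (0, 1); (0, -1); (1, 0); (-1, 0) : R * R])
  (fun v av => fin v (mem_set av)).
apply: (sub_finite_set _ fin) => C [hC [u Cu zu]].
have [Ku Qu] := components_sub hC Cu.
have [w Cw Fw] := boundary_bumping cK kK cQ Ku Qu nKQ.
rewrite -(componentsP hC Cu) in Cw.
have [Kw Qw] := components_sub hC Cw.
have zw : `|z - w| = r.
  apply/le_anti/andP; split; first exact/squareP.
  rewrite leNgt; apply/negP => zw.
  have [|y [_ nQ] wy] := (closure_normP _ _).1 Fw (r - `|z - w|); first by rewrite subr_gt0.
  by apply: nQ; apply/squareP; have := ler_distD w z y; lra.
have [v av vw] := norm_axis r0 zw.
exists v => //; split => //; last by exists w.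
by exists u => //; exact: level_half.
Qed.

(** Only finitely many components of the trace of [K] come close to the centre,
    and those that do not contain it form a closed set. *)
Lemma component_neighbourhood K z r : compact K -> connected K -> K z -> 0 < r ->
  (forall v a b, v != 0 -> a < b -> finite_set (crossing_components (turn v @` K) a b)) ->
  exists2 e, 0 < e & forall u, K u -> `|z - u| < e ->
    connected_component (K `&` square z r) z u.
Proof.
move=> cK kK Kz r0 hK.
have fin := finite_square_components cK kK Kz r0 hK.
set F := [set C | _] in fin; pose Cz := connected_component (K `&` square z r) z.
have cKQ : closed (K `&` square z r).
  apply: closedI; first exact: closed_compact_hausdorff.
  exact: (closed_compact_hausdorff (@box_compact _ _ _ _ _)).
have cO : closed (\bigcup_(C in F `\ Cz) C).
  apply: closed_bigcup; first exact: finite_setD.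
  by move=> C [[[w Kw <-] _] _]; exact: component_closed.
have nOz : ~ (\bigcup_(C in F `\ Cz) C) z.
  by move=> [C [[hC _] nC] zC]; apply: nC; exact: componentsP hC zC.
have [e e0 he] := (closed_normP _).1 cO _ nOz.
exists (Num.min e (r / 2)); first by rewrite lt_min e0 divr_gt0.
move=> u Ku; rewrite lt_min => /andP[zu zur].
have KQu : (K `&` square z r) u.
  by split => //; apply/squareP; lra.
pose Cu := connected_component (K `&` square z r) u.
have Cuu : Cu u by exact: connected_component_refl.
have [E|nE] := pselect (Cu = Cz); first by rewrite -/Cz -E.
have : e <= `|z - u|.
  apply: he; exists Cu => //; split => //; split; first by exists u.
  by exists u => //; exact: ltW.
by rewrite leNgt zu.
Qed.

(** By [component_neighbourhood], components of traces of [K] on open sets are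
    open in [K]; they are the required connected neighbourhoods. *)
Theorem finite_crossings_locally_connected K : compact K -> connected K ->
  (forall v a b, v != 0 -> a < b -> finite_set (crossing_components (turn v @` K) a b)) ->
  locally_connected K.
Proof.
move=> cK kK hK z V Kz /nbhs_normP[r0 r00 rV].
pose B := ball z r0; pose C := connected_component (K `&` B) z.
have KBz : (K `&` B) z by split => //; exact: ballxx.
have CKB : C `<=` K `&` B by exact: connected_component_sub.
have Cnear u : C u -> exists2 e, 0 < e & forall w, K w -> `|u - w| < e -> C w.
  move=> Cu; have [Ku Bu] := CKB _ Cu.
  have /nbhs_normP[r r1 rB] : nbhs u B by apply: open_nbhs_nbhs; split => //; exact: ball_open.
  have r2 : 0 < r / 2 by rewrite divr_gt0.
  have [e e0 he] := component_neighbourhood cK kK Ku r2 hK.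
  exists e => // w Kw /(he _ Kw); rewrite /C (same_connected_component Cu).
  apply: connected_component_max; last exact: component_connected.
    by apply: connected_component_refl; split => //; apply/squareP; rewrite subrr normr0 ltW.
  move=> y /connected_component_sub[Ky /squareP uy]; split => //.
  by apply: rB; apply: le_lt_trans uy _; rewrite ltr_pdivrMr // ltr_pMr // ltr1n.
have CO : K `&` ~` closure (K `\` C) = C.
  rewrite eqEsubset; split=> [u [Ku nu]|u Cu].
    by apply: contrapT => nCu; apply: nu; apply: subset_closure.
  have [Ku _] := CKB _ Cu; split => // /closure_normP Fu.
  have [e e0 he] := Cnear _ Cu; have [w [Kw nCw] uw] := Fu _ e0.
  by apply: nCw; exact: he.
exists (~` closure (K `\` C)); split.
- by apply: closed_openC; exact: closed_closure.
- have [] // : (K `&` ~` closure (K `\` C)) z.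
  by rewrite CO; exact: connected_component_refl.
- by rewrite CO => u /CKB[_ Bu]; apply: rV; move: Bu; rewrite /B -ball_normE.
- by rewrite CO; exact: component_connected.
Qed.

End Assembly.

Theorem theorem2 (R : realType) (K : set (R * R)) (K_continuum : continuum K) :
  locally_connected K <-> schoenflies K.
Proof.
have [cK kK] := K_continuum; split=> [lcK|sK].
  apply: finite_crossings_schoenflies => v a b v0 ab.
  apply: locally_connected_finite_crossings => //.
    by apply: continuous_compact => //; apply: continuous_subspaceT; exact: turn_cts.
  apply: (image_locally_connected (@turn_cts _ v) (@unturn_cts _ v) (turnK v0)) => //.
apply: finite_crossings_locally_connected => // v a b v0 ab.
exact: schoenflies_finite_crossings.
Qed.
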